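(* Let $A$ be any of the convolution algebras $L^p(\mathbb{T})$, for $1<p\le\infty$, or $C(\mathbb{T})$, where $\mathbb{T}$ is the circle group. Then there exists an orthogonally additive, continuous $2$-homogeneous polynomial $P\colon A\to\mathbb{C}$ which cannot be expressed in the form $P(f)=\Phi(f\ast f)$ $(f\in A)$ for any continuous linear functional $\Phi\colon A\to\mathbb{C}$.
   Context: All algebras and linear spaces are complex. $\mathbb{T}=\{z\in\mathbb{C} : |z|=1\}$ with normalized Haar measure; $L^p(\mathbb{T})$ and $C(\mathbb{T})$ carry their usual norms ($\|\cdot\|_p$ and the supremum norm, respectively) and are regarded as Banach algebras under convolution $\ast$. A map $P\colon E\to Y$ between linear spaces is a $2$-homogeneous polynomial if there is a bilinear map $\varphi\colon E^2\to Y$ with $P(x)=\varphi(x,x)$ for all $x\in E$. A map $P\colon A\to Y$ from an algebra $A$ to a linear space $Y$ is orthogonally additive if $P(a+b)=P(a)+P(b)$ whenever $a,b\in A$ satisfy $ab=ba=0$ (here the product is convolution). Continuity of $P$ and $\Phi$ is with respect to the usual norm of $A$. *)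

(* Defs.v *)
From HB Require Import structures.
From mathcomp Require Import all_boot all_order all_algebra.
From mathcomp Require Import all_classical all_reals all_analysis.
From mathcomp Require Import measurable_realfun.
From mathcomp Require Import complex lra.

Set Implicit Arguments.
Unset Strict Implicit.
Unset Printing Implicit Defensive.
Import Order.TTheory GRing.Theory Num.Theory.
Import numFieldNormedType.Exports.
Import ComplexField.Normc.

Local Open Scope classical_set_scope.
Local Open Scope ring_scope.
Local Open Scope complex_scope.

(* [R[i]^o] carries the norm topology of the complex plane; a set coerced to a
   type carries the subspace topology. *)
Definition circle (R : realType) : Type := [set z : R[i]^o | `|z| = 1].

HB.instance Definition _ (R : realType) := Topological.on (circle R).

Definition circle1 (R : realType) : circle R := SigSub (mem_set (normr1 _)).

HB.instance Definition _ (R : realType) := isPointed.Build (circle R) (circle1 R).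

(* the circle with its Borel sigma-algebra *)
Notation circleB R := (g_sigma_algebraType (@open (circle R))).

Section circle.
Variable R : realType.

Lemma norm_circle_ldiv (z w : circle R) :
  `| (\val z : R[i])^-1 * \val w | = 1.
Proof.
by rewrite normrM normfV (set_mem (valP z)) (set_mem (valP w)) invr1 mul1r.
Qed.

(* the element z^-1 * w of the circle group *)
Definition circle_ldiv (z w : circle R) : circle R :=
  SigSub (mem_set (norm_circle_ldiv z w)).

Lemma norm_expi (t : R) : `| cos t +i* sin t | = 1 :> R[i].
Proof. by rewrite normc_def/= cos2Dsin2 sqrtr1. Qed.

Definition circle_exp (t : measurableTypeR R) : circleB R :=
  SigSub (mem_set (norm_expi (2 * pi * t))).

Lemma continuous_circle_exp : continuous (circle_exp : R -> circle R).
Proof.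
apply: continuous_comp_initial => t.
have -> : set_val \o (circle_exp : R -> circle R) =
    (fun t => cos (2 * pi * t) +i* sin (2 * pi * t) : R[i]^o) by [].
apply/cvgrPdist_lt => e.
rewrite ltcE/= => /andP[/eqP ime e0].
have cc : {for t, continuous (fun t : R => cos (2 * pi * t))}.
  apply: continuous_comp; last exact: continuous_cos.
  by apply: continuousM; [exact: cst_continuous|exact: id].
have cs : {for t, continuous (fun t : R => sin (2 * pi * t))}.
  apply: continuous_comp; last exact: continuous_sin.
  by apply: continuousM; [exact: cst_continuous|exact: id].
have e20 : 0 < complex.Re e / 2 by rewrite divr_gt0.
move/cvgrPdist_lt : cc => /(_ _ e20) cc.
move/cvgrPdist_lt : cs => /(_ _ e20) cs.
near=> u.
have hc : `|cos (2 * pi * t) - cos (2 * pi * u)| < complex.Re e / 2 by near: u.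
have hs : `|sin (2 * pi * t) - sin (2 * pi * u)| < complex.Re e / 2 by near: u.
rewrite ltcE/= ime eqxx/=.
set a := cos _ - _ in hc *; set b := sin _ - _ in hs *.
have -> : complex.Re e = Num.sqrt (complex.Re e ^+ 2).
  by rewrite sqrtr_sqr gtr0_norm.
rewrite ltr_sqrt ?exprn_gt0//.
have ha2 : a ^+ 2 < (complex.Re e / 2) ^+ 2.
  by rewrite -(real_normK (num_real a)) ltr_pXn2r// nnegrE ltW.
have hb2 : b ^+ 2 < (complex.Re e / 2) ^+ 2.
  by rewrite -(real_normK (num_real b)) ltr_pXn2r// nnegrE ltW.
apply: (lt_trans (ltrD ha2 hb2)).
have /(exprn_gt0 2) : 0 < complex.Re e by [].
nra.
Unshelve. all: by end_near.
Qed.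

Lemma measurable_circle_exp : measurable_fun setT circle_exp.
Proof.
apply: (@measurability _ _ _ _ setT circle_exp (@open (circle R))) => //.
move=> _ [A oA <-]; rewrite setTI; apply: open_measurable.
by move/continuousP : continuous_circle_exp; exact.
Qed.

HB.instance Definition _ := isMeasurableFun.Build _ _ _ _ circle_exp
  measurable_circle_exp.

(* The normalized Haar measure: the image of the normalized Lebesgue measure on
   [0, 1] under t |-> exp (2 pi i t). *)
Definition haar := distribution (uniform_prob (@ltr01 R)) circle_exp.

HB.instance Definition _ := Probability.on haar.

(* Real and imaginary parts are integrated separately. [Rintegral] is 0 where
   the integral does not converge absolutely; for f and g integrable this
   affects only a null set of points w. *)
Definition convolution (f g : circleB R -> R[i]) : circleB R -> R[i] := fun w =>
  (\int[haar]_z complex.Re (f z * g (circle_ldiv z w))) +i*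
  (\int[haar]_z complex.Im (f z * g (circle_ldiv z w))).

End circle.
Arguments haar R : clear implicits.

(* A convolution algebra is given by the functions representing its elements
   ([ca_carrier]), the relation saying that two of them represent the same
   element ([ca_eq]) and the norm. Its elements are the classes of [ca_carrier]
   modulo [ca_eq], so a map on the algebra is a map on functions compatible with
   [ca_eq]; its values outside [ca_carrier] are irrelevant. Linear operations
   are pointwise and the product is [convolution]. *)
Record convAlgebra (R : realType) := ConvAlgebra {
  ca_carrier : set (circleB R -> R[i]) ;
  ca_eq : (circleB R -> R[i]) -> (circleB R -> R[i]) -> Prop ;
  ca_norm : (circleB R -> R[i]) -> R }.

Section algebras.
Variable R : realType.
Local Notation F := (circleB R -> R[i]).

Definition Lp_norm (p : \bar R) (f : F) : \bar R :=
  'N[haar R]_p[(fun z => (normc (f z))%:E)]%E.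

Definition Lp_circle (p : \bar R) : convAlgebra R := {|
  ca_carrier := [set f | [/\ measurable_fun setT (fun z => complex.Re (f z)),
                             measurable_fun setT (fun z => complex.Im (f z)) &
                             (Lp_norm p f < +oo)%E]] ;
  ca_eq := fun f g => f = g %[ae haar R] ;
  ca_norm := fun f => fine (Lp_norm p f) |}.

Definition C_circle : convAlgebra R := {|
  ca_carrier := [set f | continuous (f : circle R -> R[i]^o)] ;
  ca_eq := fun f g => f = g ;
  ca_norm := fun f => sup [set normc (f z) | z in setT] |}.

End algebras.

Section maps.
Variables (R : realType) (A : convAlgebra R).
Local Notation F := (circleB R -> R[i]).
Local Notation carrier := (ca_carrier A).

Definition well_defined (T : F -> R[i]) :=
  forall f g, carrier f -> carrier g -> ca_eq A f g -> T f = T g.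

Definition linear_functional (T : F -> R[i]) :=
  well_defined T /\
  forall (a : R[i]) f g, carrier f -> carrier g ->
    T (a \*o f \+ g) = a * T f + T g.

Definition bilinear_form (phi : F -> F -> R[i]) :=
  (forall f, carrier f -> linear_functional (phi f)) /\
  (forall g, carrier g -> linear_functional (phi^~ g)).

(* [P] is compatible with [ca_eq] because [phi] is. *)
Definition homogeneous2_polynomial (P : F -> R[i]) :=
  exists2 phi, bilinear_form phi & forall f, carrier f -> P f = phi f f.

Definition orthogonally_additive (P : F -> R[i]) :=
  forall f g, carrier f -> carrier g ->
    ca_eq A (convolution f g) (cst 0) -> ca_eq A (convolution g f) (cst 0) ->
    P (f \+ g) = P f + P g.

Definition continuous_on_algebra (T : F -> R[i]) :=
  forall f, carrier f -> forall e : R, 0 < e -> exists2 d : R, 0 < d &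
    forall g, carrier g -> ca_norm A (g \- f) < d -> normc (T g - T f) < e.

End maps.

(* Main.v *)
Require Import Defs.
From HB Require Import structures.
From mathcomp Require Import all_boot all_order all_algebra.
From mathcomp Require Import all_classical all_reals all_analysis.
From mathcomp Require Import measurable_realfun ess_sup_inf.
From mathcomp Require Import complex ring lra zify.
Set Implicit Arguments.
Unset Strict Implicit.
Unset Printing Implicit Defensive.
Import Order.TTheory GRing.Theory Num.Theory.
Import numFieldNormedType.Exports.
Import ComplexField.Normc.
Local Open Scope classical_set_scope.
Local Open Scope ring_scope.
Local Open Scope complex_scope.

(** The polynomial is P(f) = sum_k fhat(M^k)^2, where fhat(n) is the n-th
    Fourier coefficient and M = m + 2 for an integer m depending on the exponent
    of the algebra.

    It is orthogonally additive because convolution multiplies Fourier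
    coefficients: f * g = 0 gives fhat(n) ghat(n) = 0 for every n
    ([coef_mul_eq0]), and the cross term in P(f + g) disappears.

    It is continuous because lacunary coefficients of an L^p function with p > 1
    are square summable ([lacunary_bound]). By duality this says that the L^q
    norm of a polynomial sum_k c_k z^(M^k) is controlled by the l^2 norm of c.
    For q = 2 l this is an inequality on the coefficients of the l-th power of
    the polynomial, and it follows by induction on the number of terms: when
    M > m >= l, the blocks of exponents contributed by the successive powers of
    the last monomial do not overlap ([energy_lacunary_exp]).

    Suppose that P(f) = Phi(f * f). Since z^n * z^n = z^n, the functional takes
    the value 1 on z^n if n is a power of M and 0 otherwise, so on polynomials it
    adds up the coefficients of lacunary exponents. The polynomials [test_poly],
    built by a recursion in the style of Riesz products and of the Rudin-Shapiro
    polynomials, are uniformly bounded on the circle for suitable parameters,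
    while these sums are unbounded; hence Phi is discontinuous already for the supremum norm
    ([functional_discontinuous]).

    All the algebras are treated at once. The argument only needs that the norm
    dominates an L^p norm with 1 < p < +oo and that it is dominated by the
    supremum norm on continuous functions; this is the predicate [admissible],
    with p = 2 for L^oo and C. *)

(* The ring scope, which is in force inside products, has its own reading of this
   notation, as the conjugation of a numeric closed field. *)
Local Notation "x ^*" := (conjc x) : ring_scope.

(** * Moduli of complex numbers and energies of lacunary polynomials *)

Section complex_modulus.
Variable R : realType.
Implicit Types x y z : R[i].

Lemma normc_ge0 x : 0 <= normc x.
Proof. by case: x => a b; exact: sqrtr_ge0. Qed.

Lemma sqr_normcE x : normc x ^+ 2 = complex.Re x ^+ 2 + complex.Im x ^+ 2.
Proof. by case: x => a b /=; rewrite sqr_sqrtr// addr_ge0// sqr_ge0. Qed.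

Lemma complexReM x y : complex.Re (x * y) =
  complex.Re x * complex.Re y - complex.Im x * complex.Im y.
Proof. by case: x y => [a b] [c d]. Qed.

Lemma complexImM x y : complex.Im (x * y) =
  complex.Re x * complex.Im y + complex.Im x * complex.Re y.
Proof. by case: x y => [a b] [c d]. Qed.

Lemma complexReD x y : complex.Re (x + y) = complex.Re x + complex.Re y.
Proof. by case: x y => [a b] [c d]. Qed.

Lemma complexImD x y : complex.Im (x + y) = complex.Im x + complex.Im y.
Proof. by case: x y => [a b] [c d]. Qed.

Lemma complexReC x : complex.Re x^* = complex.Re x. Proof. by case: x. Qed.
Lemma complexImC x : complex.Im x^* = - complex.Im x. Proof. by case: x. Qed.

Lemma conjcM x y : (x * y)^* = x^* * y^*.
Proof. exact: (rmorphM (@conjc R)). Qed.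

Lemma mulcJ x : x * x^* = (normc x ^+ 2)%:C.
Proof.
apply/eqP; rewrite eq_complex complexReM complexImM complexReC complexImC.
rewrite sqr_normcE /=.
by apply/andP; split; apply/eqP; ring.
Qed.

Lemma normc_conj x : normc x^* = normc x.
Proof. by case: x => a b /=; rewrite sqrrN. Qed.

Lemma normcX x n : normc (x ^+ n) = normc x ^+ n.
Proof. by elim: n => [|n IH]; rewrite ?expr0 ?normc1// !exprS normcM IH. Qed.

Lemma normc_real (a : R) : normc a%:C = `|a|.
Proof. by rewrite /= expr0n/= addr0 sqrtr_sqr. Qed.

Lemma normc_sum (I : Type) (r : seq I) (P : pred I) (F : I -> R[i]) :
  normc (\sum_(i <- r | P i) F i) <= \sum_(i <- r | P i) normc (F i).
Proof.
elim/big_rec2 : _ => [|i y1 y2 _ h]; first by rewrite normc0.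
by rewrite (le_trans (le_normcD _ _))// lerD2l.
Qed.

Lemma normRe_le x : `|complex.Re x| <= normc x.
Proof.
rewrite -(@ler_pXn2r _ 2) ?nnegrE ?normc_ge0// sqr_normcE real_normK ?num_real//.
by rewrite lerDl sqr_ge0.
Qed.

Lemma normIm_le x : `|complex.Im x| <= normc x.
Proof.
rewrite -(@ler_pXn2r _ 2) ?nnegrE ?normc_ge0// sqr_normcE real_normK ?num_real//.
by rewrite lerDr sqr_ge0.
Qed.

Lemma le_normc_ReIm x : normc x <= `|complex.Re x| + `|complex.Im x|.
Proof.
rewrite -(@ler_pXn2r _ 2) ?nnegrE ?normc_ge0 ?addr_ge0// sqr_normcE.
rewrite sqrrD !real_normK ?num_real// -addrA lerD2l lerDr.
by rewrite mulrn_wge0// mulr_ge0.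
Qed.

End complex_modulus.

Section coefficient_energy.
Variable R : realType.
Implicit Types (p q a b : {poly R[i]}).

(** By Parseval this is the squared L^2 norm of the polynomial on the circle. *)
Definition energy q : R := \sum_(i < size q) normc q`_i ^+ 2.

Lemma energyE n q : (size q <= n)%N -> energy q = \sum_(i < n) normc q`_i ^+ 2.
Proof.
move=> qn; rewrite /energy.
rewrite [RHS](bigID (fun i : 'I_n => (i < size q)%N))/=.
rewrite [X in _ + X]big1 ?addr0.
  by rewrite (big_ord_widen n (fun i => normc q`_i ^+ 2)).
by move=> i; rewrite -leqNgt => h; rewrite nth_default// normc0 expr0n.
Qed.

Lemma energyZ (c : R[i]) q : energy (c *: q) = normc c ^+ 2 * energy q.
Proof.
rewrite (@energyE (size q)) ?size_scale_leq// mulr_sumr.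
by apply: eq_bigr => i _; rewrite coefZ normcM exprMn.
Qed.

(** The two summands have disjoint sets of exponents. *)
Lemma energy_addXn n a b : (size a <= n)%N ->
  energy (a + 'X^n * b) = energy a + energy b.
Proof.
move=> an; rewrite (@energyE (n + size b)); last first.
  rewrite (leq_trans (size_polyD _ _))// geq_max (leq_trans an) ?leq_addr//=.
  rewrite (leq_trans (size_polyMleq _ _))// size_polyXn.
  by rewrite addSn.
rewrite big_split_ord/= (energyE an); congr +%R.
  apply: eq_bigr => i _.
  by rewrite coefD coefXnM ltn_ord addr0.
apply: eq_bigr => i _.
rewrite coefD coefXnM ltnNge leq_addr/= addKn nth_default ?add0r//.
by rewrite (leq_trans an) ?leq_addr.
Qed.

Lemma energy0 : energy 0 = 0.
Proof. by rewrite /energy size_poly0 big_ord0. Qed.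

Lemma energy_sum n l (r : nat -> {poly R[i]}) :
  (forall j, (size (r j) <= n)%N) ->
  energy (\sum_(j < l) 'X^n ^+ j * r j) = \sum_(j < l) energy (r j).
Proof.
elim: l r => [|l IH] r hr; first by rewrite !big_ord0 energy0.
rewrite !big_ord_recl expr0 mul1r -(IH (fun j => r j.+1))//.
rewrite -(energy_addXn _ (hr 0%N)) mulr_sumr; congr (energy (_ + _)).
by apply: eq_bigr => i _; rewrite lift0 exprS mulrA.
Qed.

Lemma leq_bin_expn l j m : (l <= m)%N -> ('C(l, j) <= m ^ j)%N.
Proof.
move=> lm; apply: leq_trans (leq_pmulr _ (fact_gt0 j)) _.
rewrite bin_ffact; elim: j l lm => [|j IH] [|l] lm //.
by rewrite ffactSS expnS leq_mul// IH// ltnW.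
Qed.

Definition lacunary (M : nat) (c : nat -> R[i]) (N : nat) : {poly R[i]} :=
  \sum_(k < N) c k *: 'X^(M ^ k).

Lemma lacunaryS M c N :
  lacunary M c N.+1 = lacunary M c N + c N *: 'X^(M ^ N).
Proof. by rewrite /lacunary big_ord_recr. Qed.

Lemma size_lacunary M c N : (0 < M)%N ->
  (size (lacunary M c N.+1) <= (M ^ N).+1)%N.
Proof.
move=> M0; apply: (leq_trans (size_sum _ _ _)).
apply/bigmax_leqP => k _; apply: (leq_trans (size_scale_leq _ _)).
by rewrite size_polyXn ltnS leq_pexp2l// -ltnS.
Qed.

(** A bound for the moment of order 2 l of a lacunary polynomial. With G the sum
    of the first N terms and n = (m+2)^N, the binomial formula expands the l-th
    power of G + x z^n into blocks z^(n j) G^(l-j). As G has degree at most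
    (m+2)^(N-1), every G^(l-j) has size at most n, the blocks do not overlap and
    their energies add up; the squared binomial coefficients are absorbed by
    'C(l, j) <= m^j. *)
Lemma energy_lacunary_exp m c N l : (0 < m)%N -> (l <= m)%N ->
  energy (lacunary m.+2 c N ^+ l) <=
    m%:R ^+ l * (\sum_(k < N) normc (c k) ^+ 2) ^+ l.
Proof.
move=> m0; elim: N l => [|N IH] l lm.
  rewrite /lacunary !big_ord0; case: l lm => [|l _].
    rewrite !expr0 mul1r /energy size_poly1 big_ord1 coef1 eqxx.
    by rewrite mulr1n normc1 expr1n.
  by rewrite !expr0n/= energy0 mulr0.
rewrite lacunaryS big_ord_recr/=.
set G := lacunary _ _ _ in IH *; set S := \sum_(k < N) _ in IH *.
set x := c N; set n := (m.+2 ^ N)%N.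
have szG j : (j <= m)%N -> (size (G ^+ j) <= n)%N.
  move=> jm; apply: (leq_trans (size_poly_exp_leq _ _)).
  rewrite /G /n; case: (N) => [|N'].
    by rewrite /lacunary big_ord0 size_poly0 mul0n.
  rewrite expnSr; apply: (@leq_ltn_trans (m.+2 ^ N' * m)).
    apply: leq_mul => //.
    by have := @size_lacunary m.+2 c N' isT; case: (size _).
  by rewrite ltn_mul2l expn_gt0/=.
have -> : (G + x *: 'X^n) ^+ l =
    \sum_(j < l.+1) 'X^n ^+ j * ((x ^+ j *+ 'C(l, j)) *: G ^+ (l - j)).
  rewrite exprDn; apply: eq_bigr => j _.
  by rewrite exprZn -!scalerAr scalerMnl [G ^+ _ * _]mulrC.
pose r j := (x ^+ j *+ 'C(l, j)) *: G ^+ (l - j).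
rewrite (energy_sum _ (r := r)); last first.
  move=> j; rewrite (leq_trans (size_scale_leq _ _))// szG//.
  by rewrite (leq_trans (leq_subr _ _)).
rewrite -exprMn mulrDr exprDn; apply: ler_sum => j _.
rewrite /r energyZ -mulr_natr normcM exprMn normcX.
have -> : normc ('C(l, j)%:R : R[i]) = 'C(l, j)%:R.
  by rewrite -(rmorph_nat (real_complex R)) normc_real ger0_norm.
have jl : (j <= l)%N by rewrite -ltnS.
apply: (@le_trans _ _ ((normc x ^+ j) ^+ 2 * 'C(l, j)%:R ^+ 2 *
    (m%:R ^+ (l - j) * S ^+ (l - j)))).
  rewrite -exprMn; apply: ler_wpM2l; first exact: sqr_ge0.
  by apply: IH; rewrite (leq_trans (leq_subr _ _)).
rewrite -[leRHS]mulr_natr [(m%:R * _) ^+ j]exprMn (exprAC (normc x)).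
set y := normc x ^+ 2 ^+ j.
have y0 : 0 <= y by rewrite !exprn_ge0// normc_ge0.
rewrite [leLHS](_ : _ = y * (m%:R ^+ (l - j) * S ^+ (l - j)) *
   'C(l, j)%:R * 'C(l, j)%:R); last by ring.
rewrite [leRHS](_ : _ = y * (m%:R ^+ (l - j) * S ^+ (l - j)) *
   'C(l, j)%:R * m%:R ^+ j); last by ring.
apply: ler_wpM2l.
  rewrite !mulr_ge0// exprn_ge0//; apply: sumr_ge0 => i _.
  by rewrite exprn_ge0// normc_ge0.
by rewrite -natrX ler_nat leq_bin_expn.
Qed.

End coefficient_energy.

(** * Bounded polynomials with large lacunary sums *)

Section lacunary_tests.
Variable R : realType.
Implicit Types p q r : {poly R[i]}.

(** On the unit circle this polynomial is z^n times the conjugate of q. *)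
Definition conj_reversal n q : {poly R[i]} := \poly_(i < n.+1) (q`_(n - i))^*.

Lemma size_conj_reversal n q : (size (conj_reversal n q) <= n.+1)%N.
Proof. exact: size_poly. Qed.

Lemma coef_conj_reversal n q i : (i <= n)%N ->
  (conj_reversal n q)`_i = (q`_(n - i))^*.
Proof. by move=> h; rewrite coef_poly ltnS h. Qed.

Lemma horner_conj_reversal n q (z : R[i]) : (size q <= n.+1)%N -> normc z = 1 ->
  (conj_reversal n q).[z] = z ^+ n * (q.[z])^*.
Proof.
move=> qn z1; have zJ : z * z^* = 1 by rewrite mulcJ z1 expr1n.
rewrite (horner_coef_wide _ (size_conj_reversal n q)) (horner_coef_wide _ qn).
rewrite rmorph_sum mulr_sumr/= [RHS](reindex_inj rev_ord_inj)/=.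
apply: eq_bigr => i _; have i_n : (i <= n)%N by rewrite -ltnS.
rewrite coef_conj_reversal// subSS rmorphM rmorphXn/= mulrCA; congr (_ * _).
have -> : z ^+ n = z ^+ i * z ^+ (n - i) by rewrite -exprD subnKC.
by rewrite -mulrA -exprMn zJ expr1n mulr1.
Qed.

Section pair.
Variables (M : nat) (t : R).

(** On the circle, with u = z^(M^k), the step maps (p, r) to the pair of
    p + t u conj(r) and r - t u conj(p). It multiplies |p|^2 + |r|^2 by 1 + t^2
    exactly, because the cross terms cancel, while p acquires the term t z^(M^k),
    as r has constant coefficient 1. *)
Fixpoint test_pair (k : nat) : {poly R[i]} * {poly R[i]} :=
  if k is k'.+1 then
    let: (p, r) := test_pair k' in
    (p + t%:C *: conj_reversal (M ^ k') r, r - t%:C *: conj_reversal (M ^ k') p)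
  else (0, 1).

Definition test_poly k := (test_pair k).1.

(** A bound for the sizes of the polynomials of stage k. *)
Definition test_size k := if k is k'.+1 then (M ^ k').+1 else 1%N.

(** For M > 1 this says that i is a power of M. *)
Definition lacunary_exp (i : nat) := i == (M ^ trunc_log M i)%N.

Definition lacunary_sum q : R[i] :=
  \sum_(i < size q) q`_i * (lacunary_exp i)%:R.

Lemma lacunary_sumE n q : (size q <= n)%N ->
  lacunary_sum q = \sum_(i < n) q`_i * (lacunary_exp i)%:R.
Proof.
move=> qn; rewrite /lacunary_sum.
rewrite [RHS](bigID (fun i : 'I_n => (i < size q)%N))/=.
rewrite [X in _ + X]big1 ?addr0.
  by rewrite (big_ord_widen n (fun i => q`_i * (lacunary_exp i)%:R)).
by move=> i; rewrite -leqNgt => h; rewrite nth_default// mul0r.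
Qed.

Lemma lacunary_sumD p q : lacunary_sum (p + q) = lacunary_sum p + lacunary_sum q.
Proof.
rewrite !(@lacunary_sumE (maxn (size p) (size q))) ?leq_maxl ?leq_maxr ?size_polyD//.
by rewrite -big_split; apply: eq_bigr => i _ /=; rewrite coefD mulrDl.
Qed.

Lemma lacunary_sumZ (c : R[i]) q : lacunary_sum (c *: q) = c * lacunary_sum q.
Proof.
rewrite (@lacunary_sumE (size q)) ?size_scale_leq// mulr_sumr.
by apply: eq_bigr => i _; rewrite coefZ mulrA.
Qed.

Hypothesis M3 : (3 <= M)%N.

Lemma lacunary_expX k : lacunary_exp (M ^ k).
Proof. by rewrite /lacunary_exp trunc_expnK// (leq_trans _ M3). Qed.

(** The exponents of the conjugate reversal of r, other than M^k itself, lie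
    strictly between two consecutive powers of M: this is where M >= 3 enters. *)
Lemma lacunary_exp_gap k i : (i < M ^ k)%N -> (M ^ k < i + test_size k)%N ->
  lacunary_exp i = false.
Proof.
move=> ik ki; apply/negbTE/negP => /eqP ie; move: ik ki; rewrite {}ie.
set j := trunc_log M i; rewrite ltn_exp2l ?(leq_trans _ M3)//.
case: k => [//|k]; rewrite ltnS => jk /=.
have := leq_pexp2l (leq_trans (isT : (0 < 3)%N) M3) jk.
have : (3 * M ^ k <= M ^ k.+1)%N by rewrite expnS leq_mul2r M3 orbT.
have : (0 < M ^ k)%N by rewrite expn_gt0 (leq_trans _ M3).
lia.
Qed.

(** Of the terms added to p at stage k, only t z^(M^k) has a lacunary exponent, so
    the lacunary sum grows by t. *)
Lemma test_pairP k :
  [/\ (size (test_pair k).1 <= test_size k)%N,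
      (size (test_pair k).2 <= test_size k)%N,
      (test_pair k).2`_0 = 1 &
      lacunary_sum (test_pair k).1 = (k%:R * t)%:C].
Proof.
elim: k => [|k] /=.
  split; rewrite ?size_poly0 ?size_poly1 ?coef1 ?eqxx//.
  by rewrite /lacunary_sum size_poly0 big_ord0 mul0r.
case: (test_pair k) => p r /= [sp sr r0 Lp].
have Mk0 : (0 < M ^ k)%N by rewrite expn_gt0 (leq_trans _ M3).
have sk : (test_size k <= M ^ k)%N.
  case: (k) => [//|k'] /=.
  by rewrite ltn_exp2l ?(leq_trans _ M3).
split.
- rewrite (leq_trans (size_polyD _ _))// geq_max (leq_trans sp (leqW sk)).
  by rewrite (leq_trans (size_scale_leq _ _))// size_conj_reversal.
- rewrite (leq_trans (size_polyD _ _))// geq_max (leq_trans sr (leqW sk)).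
  by rewrite size_polyN (leq_trans (size_scale_leq _ _))// size_conj_reversal.
- rewrite coefB coefZ coef_conj_reversal// subn0 r0 nth_default ?(leq_trans sp)//.
  by rewrite rmorph0 mulr0 subr0.
- rewrite lacunary_sumD lacunary_sumZ Lp.
  suff -> : lacunary_sum (conj_reversal (M ^ k) r) = 1.
    by rewrite mulr1 -rmorphD -natr1 mulrDl mul1r.
  rewrite (lacunary_sumE (size_conj_reversal _ _)) big_ord_recr/= lacunary_expX mulr1.
  rewrite coef_conj_reversal// subnn r0 rmorph1 big1 ?add0r// => i _.
  have iM := ltn_ord i; have [h|h] := ltnP (M ^ k) (i + test_size k).
    by rewrite (lacunary_exp_gap iM h) mulr0.
  rewrite coef_conj_reversal ?(ltnW iM)// nth_default ?rmorph0 ?mul0r//.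
  rewrite (leq_trans sr)//; lia.
Qed.

Lemma lacunary_sum_test k : lacunary_sum (test_poly k) = (k%:R * t)%:C.
Proof. by case: (test_pairP k). Qed.

Lemma normc_test_pair k (z : R[i]) : normc z = 1 ->
  normc (test_pair k).1.[z] ^+ 2 + normc (test_pair k).2.[z] ^+ 2 =
  (1 + t ^+ 2) ^+ k.
Proof.
move=> z1; elim: k => [|k] /=.
  by rewrite hornerC hornerE normc0 normc1 expr0n/= expr1n add0r.
have [] := test_pairP k; case: (test_pair k) => p r /= sp sr _ _ IH.
have sk : (test_size k <= (M ^ k).+1)%N.
  case: (k) => [//|k'] /=.
  by rewrite ltnS leq_exp2l ?(leq_trans _ M3).
rewrite !hornerD hornerN !hornerZ !horner_conj_reversal ?(leq_trans _ sk)//.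
rewrite [RHS]exprSr -IH.
set u := z ^+ _; have : normc u = 1 by rewrite normcX z1 expr1n.
move=> /(congr1 (fun x => x ^+ 2)); rewrite expr1n !sqr_normcE.
move: u p.[z] r.[z] => [u1 u2] [a b] [c d] /= u12.
have {}u12 : u1 ^+ 2 = 1 - u2 ^+ 2 by rewrite -u12 addrK.
ring: u12.
Qed.

Lemma normc_test_poly k (z : R[i]) : normc z = 1 ->
  normc (test_poly k).[z] ^+ 2 <= (1 + t ^+ 2) ^+ k.
Proof. by move=> /(normc_test_pair k) <-; rewrite lerDl sqr_ge0. Qed.

End pair.
End lacunary_tests.

(** * Integrals of complex-valued functions *)

Section complex_measurability.
Context d (T : measurableType d) (R : realType).
Implicit Types f g : T -> R[i].

Definition cmeasurable f :=
  measurable_fun setT (fun z => complex.Re (f z)) /\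
  measurable_fun setT (fun z => complex.Im (f z)).

Lemma cmeasurableD f g : cmeasurable f -> cmeasurable g ->
  cmeasurable (fun z => f z + g z).
Proof.
move=> [f1 f2] [g1 g2]; split.
- by under eq_fun do rewrite complexReD; exact: measurable_funD.
- by under eq_fun do rewrite complexImD; exact: measurable_funD.
Qed.

Lemma cmeasurableM f g : cmeasurable f -> cmeasurable g ->
  cmeasurable (fun z => f z * g z).
Proof.
move=> [f1 f2] [g1 g2]; split.
- under eq_fun do rewrite complexReM.
  by apply: measurable_funB; exact: measurable_funM.
- under eq_fun do rewrite complexImM.
  by apply: measurable_funD; exact: measurable_funM.
Qed.

Lemma cmeasurable_cst (a : R[i]) : cmeasurable (fun=> a).
Proof. by split; exact: measurable_cst. Qed.

Lemma cmeasurableJ f : cmeasurable f -> cmeasurable (fun z => (f z)^*).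
Proof.
move=> [f1 f2]; split.
- by under eq_fun do rewrite complexReC.
- by under eq_fun do rewrite complexImC; exact: measurableT_comp.
Qed.

Lemma cmeasurableX f n : cmeasurable f -> cmeasurable (fun z => f z ^+ n).
Proof.
move=> mf; elim: n => [|n IH].
  by under eq_fun do rewrite expr0; exact: cmeasurable_cst.
by under eq_fun do rewrite exprS; exact: cmeasurableM.
Qed.

Lemma normcE_ReIm (x : R[i]) :
  normc x = Num.sqrt (complex.Re x ^+ 2 + complex.Im x ^+ 2).
Proof. by case: x. Qed.

Lemma measurable_normc f : cmeasurable f ->
  measurable_fun setT (fun z => normc (f z)).
Proof.
move=> [f1 f2].
have -> : (fun z => normc (f z)) = (fun x => x `^ 2^-1) \o
    (fun z => complex.Re (f z) ^+ 2 + complex.Im (f z) ^+ 2).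
  by apply/funext => z /=; rewrite powR12_sqrt -?normcE_ReIm// addr_ge0 ?sqr_ge0.
apply: measurableT_comp; first exact: measurable_powR.
by apply: measurable_funD; exact: measurable_funX.
Qed.

End complex_measurability.

Section complex_integral.
Context d (T : measurableType d) (R : realType) (mu : {measure set T -> \bar R}).
Implicit Types f g : T -> R[i].

Definition cintegrable f :=
  mu.-integrable setT (fun z => (complex.Re (f z))%:E) /\
  mu.-integrable setT (fun z => (complex.Im (f z))%:E).

Definition cint f : R[i] :=
  (\int[mu]_z complex.Re (f z)) +i* (\int[mu]_z complex.Im (f z)).

Lemma cintegrable_measurable f : cintegrable f -> cmeasurable f.
Proof.
move=> [/measurable_int/measurable_EFinP ? /measurable_int/measurable_EFinP ?].
by [].
Qed.

(** The modulus lies between each of |Re|, |Im| and their sum. *)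
Lemma cintegrable_normcP f : cmeasurable f ->
  cintegrable f <-> mu.-integrable setT (fun z => (normc (f z))%:E).
Proof.
move=> mf; have [f1 f2] := mf; split=> [[i1 i2]|h].
- apply: (@le_integrable _ _ _ mu setT _ _
    (fun z => `|(complex.Re (f z))%:E| + `|(complex.Im (f z))%:E|)%E) => //.
  + exact/measurable_EFinP/measurable_normc.
  + move=> z _ /=; rewrite lee_fin ger0_norm ?normc_ge0//.
    by rewrite ger0_norm ?addr_ge0// le_normc_ReIm.
  + by apply: integrableD => //; exact: integrable_abse.
- split; apply: (le_integrable _ _ _ h) => //; try exact/measurable_EFinP.
  + by move=> z _ /=; rewrite lee_fin [leRHS]ger0_norm ?normc_ge0// normRe_le.
  + by move=> z _ /=; rewrite lee_fin [leRHS]ger0_norm ?normc_ge0// normIm_le.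
Qed.

Lemma cintegrableD f g : cintegrable f -> cintegrable g ->
  cintegrable (fun z => f z + g z).
Proof.
move=> [f1 f2] [g1 g2]; split.
- by under eq_fun do rewrite complexReD EFinD; exact: integrableD.
- by under eq_fun do rewrite complexImD EFinD; exact: integrableD.
Qed.

Lemma cintegrableZ (a : R[i]) f : cintegrable f -> cintegrable (fun z => a * f z).
Proof.
move=> [f1 f2]; split.
- under eq_fun do rewrite complexReM EFinB !EFinM.
  by apply: integrableB => //; exact: integrableZl.
- under eq_fun do rewrite complexImM EFinD !EFinM.
  by apply: integrableD => //; exact: integrableZl.
Qed.

Lemma cintD f g : cintegrable f -> cintegrable g ->
  cint (fun z => f z + g z) = cint f + cint g.
Proof.
move=> [f1 f2] [g1 g2]; apply/eqP.
rewrite eq_complex complexReD complexImD /= -!RintegralD//.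
by apply/andP; split; apply/eqP/eq_Rintegral => z _; rewrite ?complexReD ?complexImD.

Qed.

Lemma cintZ (a : R[i]) f : cintegrable f -> cint (fun z => a * f z) = a * cint f.
Proof.
case: a => a b [f1 f2].
have hZ (c : R) (g : T -> R) : mu.-integrable setT (fun z => (g z)%:E) ->
    mu.-integrable setT (EFin \o (fun z => c * g z)).
  by move=> gi; exact: (integrableZl measurableT c gi).
rewrite /cint /=; congr (_ +i* _).
- rewrite -!RintegralZl// -RintegralB//; [|exact: hZ..].
  by apply: eq_Rintegral => z _; rewrite complexReM.
- rewrite -!RintegralZl// -RintegralD//; [|exact: hZ..].
  by apply: eq_Rintegral => z _; rewrite complexImM.
Qed.

Lemma cintegrable0 : cintegrable (fun=> 0).
Proof. by split; exact: integrable0. Qed.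

Lemma cint0 : cint (fun=> 0) = 0.
Proof. by rewrite /cint /Rintegral !integral0. Qed.

Lemma cintegrable_sum n (f : nat -> T -> R[i]) :
  (forall k, cintegrable (f k)) -> cintegrable (fun z => \sum_(k < n) f k z).
Proof.
move=> h; elim: n => [|n IH].
  by under eq_fun do rewrite big_ord0; exact: cintegrable0.
by under eq_fun do rewrite big_ord_recr/=; exact: cintegrableD.
Qed.

Lemma cint_sum n (f : nat -> T -> R[i]) : (forall k, cintegrable (f k)) ->
  cint (fun z => \sum_(k < n) f k z) = \sum_(k < n) cint (f k).
Proof.
move=> h; elim: n => [|n IH].
  by under eq_fun do rewrite big_ord0; rewrite cint0 big_ord0.
under eq_fun do rewrite big_ord_recr/=.
by rewrite cintD// ?IH ?big_ord_recr//; exact: cintegrable_sum.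
Qed.

Lemma cintegrableM_bounded f g (C : R) : cintegrable f -> cmeasurable g ->
  (forall z, normc (g z) <= C) -> cintegrable (fun z => f z * g z).
Proof.
move=> fi mg gC; have mf := cintegrable_measurable fi.
apply/cintegrable_normcP; first exact: cmeasurableM.
move/(cintegrable_normcP mf) : fi => fi.
apply: (@le_integrable _ _ _ mu setT _ _ (fun z => (C%:E * (normc (f z))%:E)%E)) => //.
- exact/measurable_EFinP/measurable_normc/cmeasurableM.
- move=> z _ /=; rewrite lee_fin normcM !ger0_norm ?mulr_ge0 ?normc_ge0//.
    by rewrite mulrC ler_wpM2r ?normc_ge0.
  by rewrite (le_trans (normc_ge0 _) (gC z)).
- exact: integrableZl.
Qed.

End complex_integral.

(** * Functions on the circle *)

Section circle_functions.
Variable R : realType.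
Local Notation C := R[i].
Local Notation cv z := (\val (z : circle R) : C).

Lemma normcE_norm (x : C) : `|x| = (normc x)%:C.
Proof. by rewrite normc_def normcE_ReIm. Qed.

Lemma normc_circle (z : circleB R) : normc (cv z) = 1.
Proof.
have : `|cv z| = 1 by exact: (set_mem (valP z)).
by rewrite normcE_norm => /complexI.
Qed.

Lemma circle_mulJ (z : circleB R) : cv z * (cv z)^* = 1.
Proof. by rewrite mulcJ normc_circle expr1n. Qed.

Lemma circle_neq0 (z : circleB R) : cv z != 0.
Proof.
apply/eqP => z0; move: (circle_mulJ z).
by rewrite z0 mul0r => /esym/eqP; rewrite oner_eq0.
Qed.

Lemma circle_inv (z : circleB R) : (cv z)^-1 = (cv z)^*.
Proof. by apply: (mulfI (circle_neq0 z)); rewrite mulfV ?circle_neq0// circle_mulJ. Qed.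

Lemma continuous_Re : continuous (fun x : C^o => complex.Re x : R).
Proof.
move=> x; have F : Filter (nbhs (x : C^o)) by exact: nbhs_filter.
apply/cvgrPdist_lt => e e0.
have e0' : (0 : C) < e%:C by rewrite ltcR.
have := nbhsx_ballx (x : C^o) _ e0'; apply: filterS => y.
rewrite -ball_normE/= normcE_norm ltcR; apply: le_lt_trans.
by have := normRe_le (x - y); rewrite complexReD; case: y.
Qed.

Lemma continuous_Im : continuous (fun x : C^o => complex.Im x : R).
Proof.
move=> x; have F : Filter (nbhs (x : C^o)) by exact: nbhs_filter.
apply/cvgrPdist_lt => e e0.
have e0' : (0 : C) < e%:C by rewrite ltcR.
have := nbhsx_ballx (x : C^o) _ e0'; apply: filterS => y.
rewrite -ball_normE/= normcE_norm ltcR; apply: le_lt_trans.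
by have := normIm_le (x - y); rewrite complexImD; case: y.
Qed.

Lemma circle_val_continuous : continuous (fun z : circle R => cv z : C^o).
Proof. exact: initial_continuous. Qed.

Lemma continuous_measurable_circle (h : circle R -> R) :
  continuous h -> measurable_fun setT (h : circleB R -> R).
Proof.
move=> ch; apply: (measurability _ (RGenOpens.measurableE R)).
move=> _ [_ [a [b ->] <-]]; rewrite setTI.
apply: sub_sigma_algebra; move/continuousP : ch; apply.
exact: interval_open.
Qed.

Lemma continuous_cmeasurable (f : circle R -> C) :
  continuous (f : circle R -> C^o) -> cmeasurable (f : circleB R -> C).
Proof.
move=> cf; split; apply: continuous_measurable_circle.
- move=> z; apply: (@continuous_comp (circle R) C^o R f (@complex.Re R) z (cf z)).
  exact: continuous_Re.
- move=> z; apply: (@continuous_comp (circle R) C^o R f (@complex.Im R) z (cf z)).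
  exact: continuous_Im.
Qed.

Lemma continuous_horner (q : {poly C}) :
  continuous (fun z : circle R => q.[cv z] : C^o).
Proof.
elim/poly_ind : q => [|q c IH] z.
  rewrite (_ : (fun w : circle R => _) = cst (0 : C^o)); first exact: cst_continuous.
  by apply/funext => w; rewrite horner0.
rewrite (_ : (fun w : circle R => _) =
    (fun w : circle R => q.[cv w] * cv w + c : C^o)).
  have h := @continuousM C _ _ _ z (IH z) (@circle_val_continuous z).
  exact: (@continuousD C C^o _ _ _ z h (@cst_continuous _ C^o c z)).
by apply/funext => w; rewrite hornerMXaddC.
Qed.

Lemma cmeasurable_circle : cmeasurable (fun z : circleB R => cv z).
Proof. exact/continuous_cmeasurable/circle_val_continuous. Qed.

Lemma measurable_circle_ldiv (w : circleB R) :
  measurable_fun setT (fun z : circleB R => circle_ldiv z w : circleB R).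
Proof.
apply: (@measurability _ _ (circleB R) (circleB R) setT
  (fun z => circle_ldiv z w) (@open (circle R))) => //.
move=> _ [A oA <-]; rewrite setTI; apply: sub_sigma_algebra.
suff /continuousP : continuous (fun z : circle R => circle_ldiv z w) by exact.
apply: continuous_comp_initial => z.
have -> : set_val \o (fun z : circle R => circle_ldiv z w) =
    (fun z : circle R => (cv z)^-1 * cv w : C^o) by [].
have h := @continuousV C _ _ z (circle_neq0 z) (@circle_val_continuous z).
exact: (@continuousM C _ _ _ z h (@cst_continuous _ C^o (cv w) z)).
Qed.

Lemma circle_ext (z w : circle R) : cv z = cv w -> z = w.
Proof. exact: val_inj. Qed.

Lemma circle_ldiv_exp (s t : R) :
  circle_ldiv (circle_exp s) (circle_exp t) = circle_exp (t - s).
Proof.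
apply: circle_ext.
rewrite -[LHS]/((cv (circle_exp s))^-1 * cv (circle_exp t)) circle_inv/=.
apply/eqP; rewrite eq_complex/= mulrBr cosB sinB.
by apply/andP; split; apply/eqP; ring.
Qed.

Lemma circle_exp_periodic (t : R) : circle_exp (t + 1) = circle_exp t.
Proof.
apply: circle_ext => /=.
have -> : 2 * pi * (t + 1) = 2 * pi * t + pi *+ 2 :> R.
  by rewrite mulrDr mulr1 [X in _ + X]mulr_natl.
by rewrite cosD2pi sinD2pi.
Qed.

End circle_functions.

(** * Translation of periodic functions *)

Section translation.
Variable R : realType.
Local Notation leb := (@lebesgue_measure R).

Definition translate (s : R) (x : measurableTypeR R) : measurableTypeR R := x + s.

Lemma measurable_translate s : measurable_fun setT (translate s).
Proof. exact: measurable_funD. Qed.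

HB.instance Definition _ s :=
  isMeasurableFun.Build _ _ _ _ (translate s) (measurable_translate s).

Lemma translate_itv s (b1 b2 : bool) (x y : R) :
  translate s @^-1` [set` Interval (BSide b1 x) (BSide b2 y)] =
  [set` Interval (BSide b1 (x - s)) (BSide b2 (y - s))].
Proof.
by apply/seteqP; split => z; case: b1; case: b2;
  rewrite /translate /= !in_itv/= ?lerBlDr ?ltrBlDr ?lerBrDr ?ltrBrDr.
Qed.

Lemma lebesgue_measure_translate s (A : set R) : measurable A ->
  pushforward leb (translate s) A = leb A.
Proof.
move=> mA; apply/esym/lebesgue_measure_unique => //= _ [[a b]] _ <-.
rewrite /pushforward translate_itv !lebesgue_measure_itv/=.
rewrite !lte_fin ltrD2r; case: ifP => // _.
by rewrite -!EFinB; congr EFin; ring.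
Qed.

Lemma ge0_integral_translate s (G : R -> \bar R) (a b : R) :
  measurable_fun setT G -> (forall x, (0 <= G x)%E) ->
  (\int[leb]_(x in `[a, b[) G (x + s)%R =
   \int[leb]_(x in `[(a + s)%R, (b + s)%R[) G x)%E.
Proof.
move=> mG G0.
have := @ge0_integral_pushforward _ _ _ _ _ (translate s) (measurable_translate s)
  leb `[a + s, b + s[%classic G (measurable_itv _).
move=> /(_ (measurable_funTS mG) (fun y _ => G0 y)).
rewrite translate_itv !addrK => <-.
by apply: eq_measure_integral => A mA _; exact: lebesgue_measure_translate.
Qed.

(** After translation by an integer one may assume 0 <= a < 1. The part of
    [a, a + 1[ beyond 1 is then moved by one period onto [0, a[. *)
Lemma ge0_integral_period (G : R -> \bar R) (a : R) :
  measurable_fun setT G -> (forall x, (0 <= G x)%E) ->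
  (forall x, G (x + 1) = G x) ->
  (\int[leb]_(x in `[a, (a + 1)%R[) G x = \int[leb]_(x in `[0%R, 1%R[) G x)%E.
Proof.
move=> mG G0 G1.
have Gz (n : int) x : G (x + n%:~R) = G x.
  have Gn (m : nat) y : G (y + m%:R) = G y.
    elim: m y => [|m IH] y; first by rewrite addr0.
    by rewrite -natr1 addrA G1.
  case: n => n; first exact: Gn.
  by rewrite NegzE mulrNz -(Gn n.+1) subrK.
wlog a01 : a / 0 <= a < 1.
  move=> h; pose n := Num.floor a; pose b := a - n%:~R.
  have b01 : 0 <= b < 1.
    by have := floor_itv a; rewrite -/n /b intrD; lra.
  rewrite -(h b b01) -[in LHS](subrK n%:~R a) -/b [(b + _ + 1)%R]addrAC.
  by rewrite -ge0_integral_translate//; apply: eq_integral => x _; rewrite Gz.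
case/andP: a01 => a0 a1.
rewrite (@itv_bndbnd_setU _ _ (BLeft a) (BLeft 1) (BLeft (a + 1)));
  [|by rewrite bnd_simp ltW|by rewrite bnd_simp lerDr].
rewrite (@itv_bndbnd_setU _ _ (BLeft 0) (BLeft a) (BLeft 1));
  [|by rewrite bnd_simp|by rewrite bnd_simp ltW].
rewrite !ge0_integral_setU//.
- rewrite addeC -[X in `[X, (a + 1)%R[%classic]add0r -ge0_integral_translate//.
  by congr (_ + _)%E; apply: eq_integral => x _; rewrite G1.
- exact: measurable_funTS.
- by apply/disj_setPS => x [] /=; rewrite !in_itv/= => /andP[_ +] /andP[+ _]; lra.
- exact: measurable_funTS.
- by apply/disj_setPS => x [] /=; rewrite !in_itv/= => /andP[_ +] /andP[+ _]; lra.
Qed.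

End translation.

(** * Haar measure *)

Section haar_integral.
Variable R : realType.
Local Notation C := R[i].
Local Notation cv z := (\val (z : circle R) : C).
Local Notation U := (uniform_prob (@ltr01 R)).
Local Notation exp := (@circle_exp R).

Lemma measurable_circle_exp_translate (s : R) :
  measurable_fun setT (fun t : measurableTypeR R => exp (t - s)).
Proof.
apply: (measurableT_comp (@measurable_circle_exp R)).
exact: measurable_funB.
Qed.

Lemma integral_haar (h : circleB R -> \bar R) : measurable_fun setT h ->
  (\int[haar R]_z h z = \int[U]_t h (exp t))%E.
Proof.
move=> mh; rewrite integralE [RHS]integralE.
rewrite !ge0_integral_distribution//; last 2 first.
- exact: measurable_funeneg.
- exact: measurable_funepos.
by congr (_ - _)%E; apply: eq_integral => t _; rewrite /= ?funeposE ?funenegE.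
Qed.

Lemma ge0_integral_uniform_shift (G : R -> \bar R) (s : R) :
  measurable_fun setT G -> (forall x, (0 <= G x)%E) ->
  (forall x, G (x + 1) = G x) ->
  (\int[U]_t G (t - s)%R = \int[U]_t G t)%E.
Proof.
move=> mG G0 G1.
have mGs : measurable_fun setT (fun t : R => G (t - s)).
  by apply: measurableT_comp => //; exact: measurable_funB.
rewrite !integral_uniform//; congr (_ * _)%E.
rewrite -!integral_itv_bndo_bndc; [|exact: measurable_funTS..].
rewrite (ge0_integral_translate (- s))// add0r addrC.
exact: ge0_integral_period.
Qed.

(** Rotation invariance of the Haar measure, read on the parameter. *)
Lemma integral_haar_shift (h : circleB R -> \bar R) (s : R) :
  measurable_fun setT h ->
  (\int[U]_t h (exp (t - s)%R) = \int[U]_t h (exp t))%E.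
Proof.
move=> mh.
have hp (k : R -> circleB R) : (fun t => h (k t))^\+%E = (fun t => h^\+%E (k t)).
  by apply/funext => t; rewrite !funeposE.
have hn (k : R -> circleB R) : (fun t => h (k t))^\-%E = (fun t => h^\-%E (k t)).
  by apply/funext => t; rewrite !funenegE.
rewrite integralE [RHS]integralE !hp !hn; congr (_ - _)%E.
- apply: (@ge0_integral_uniform_shift (fun t => h^\+ (exp t))%E).
  + apply: (measurableT_comp (measurable_funepos mh)); exact: measurable_circle_exp.
  + by move=> x.
  + by move=> x; rewrite circle_exp_periodic.
- apply: (@ge0_integral_uniform_shift (fun t => h^\- (exp t))%E).
  + apply: (measurableT_comp (measurable_funeneg mh)); exact: measurable_circle_exp.
  + by move=> x.
  + by move=> x; rewrite circle_exp_periodic.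
Qed.

Lemma integrable_haar (h : circleB R -> \bar R) (s : R) :
  (haar R).-integrable setT h ->
  U.-integrable setT (fun t => h (exp (t - s))).
Proof.
move=> /integrableP[mh hi]; apply/integrableP; split.
  exact: (measurableT_comp mh (measurable_circle_exp_translate s)).
rewrite (@integral_haar_shift (abse \o h)); last exact: measurableT_comp.
by rewrite -(@integral_haar (abse \o h))//; exact: measurableT_comp.
Qed.

Lemma cintegrable_haar (f : circleB R -> C) (s : R) : cintegrable (haar R) f ->
  cintegrable U (fun t => f (exp (t - s))).
Proof.
move=> [f1 f2]; split.
- exact: (@integrable_haar (fun z => (complex.Re (f z))%:E)).
- exact: (@integrable_haar (fun z => (complex.Im (f z))%:E)).
Qed.

Lemma cint_haar (f : circleB R -> C) (s : R) : cmeasurable f ->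
  cint U (fun t => f (exp (t - s))) = cint (haar R) f.
Proof.
move=> [f1 f2]; rewrite /cint /Rintegral.
rewrite (@integral_haar_shift (fun z => (complex.Re (f z))%:E));
  last exact/measurable_EFinP.
rewrite (@integral_haar_shift (fun z => (complex.Im (f z))%:E));
  last exact/measurable_EFinP.
rewrite -(@integral_haar (fun z => (complex.Re (f z))%:E));
  last exact/measurable_EFinP.
by rewrite -(@integral_haar (fun z => (complex.Im (f z))%:E));
  last exact/measurable_EFinP.
Qed.

Lemma cint_haar0 (f : circleB R -> C) : cmeasurable f ->
  cint U (fun t => f (exp t)) = cint (haar R) f.
Proof.
move=> mf; rewrite -(cint_haar 0 mf).
by congr cint; apply/funext => t; rewrite subr0.
Qed.

Lemma cintegrable_haar0 (f : circleB R -> C) : cintegrable (haar R) f ->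
  cintegrable U (fun t => f (exp t)).
Proof.
move=> fi; have -> : (fun t : R => f (exp t)) = (fun t => f (exp (t - 0))).
  by apply/funext => t; rewrite subr0.
exact: cintegrable_haar.
Qed.

Lemma circle_expD (s t : R) : cv (exp (s + t)) = cv (exp s) * cv (exp t).
Proof.
by apply/eqP; rewrite eq_complex/= mulrDr cosD sinD; apply/andP; split => //;
  rewrite addrC.
Qed.

Lemma circle_expX (t : R) n : cv (exp t) ^+ n = cv (exp (t *+ n)).
Proof.
elim: n => [|n IH].
  rewrite expr0 mulr0n; apply/esym/eqP.
  by rewrite eq_complex/= mulr0 cos0 sin0 !eqxx.
by rewrite exprS IH -circle_expD mulrS.
Qed.

Lemma circle_exp_half : cv (exp 2^-1) = -1.
Proof.
apply/eqP.
by rewrite eq_complex/= mulrC mulrA mulVf// mul1r cospi sinpi oppr0 !eqxx.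
Qed.

Lemma cmeasurable_monomial i j :
  cmeasurable (fun z : circleB R => cv z ^+ i * (cv z)^* ^+ j).
Proof.
apply: cmeasurableM; apply: cmeasurableX; first exact: cmeasurable_circle.
by apply: cmeasurableJ; exact: cmeasurable_circle.
Qed.

Lemma cint_cst (a : C) : cint (haar R) (fun=> a) = a.
Proof.
rewrite /cint !Rintegral_cst//.
have h : fine (haar R setT) = 1.
  by have -> : haar R setT = 1%E := probability_setT _.
transitivity ((complex.Re a * 1) +i* (complex.Im a * 1)); last first.
  by rewrite !mulr1; case: a.
by congr ((_ * _) +i* (_ * _)); exact: h.
Qed.

(** The rotation by the point where the monomial takes the value -1 reverses the
    sign of its integral. *)
Lemma cint_monomial i j :
  cint (haar R) (fun z => cv z ^+ i * (cv z)^* ^+ j) = (i == j)%:R.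
Proof.
have mulJX z n : cv z ^+ n * (cv z)^* ^+ n = 1.
  by rewrite -exprMn circle_mulJ expr1n.
set h := fun z : circleB R => _.
have hM (s t : R) : h (exp (t - s)) = h (exp (- s)) * h (exp t).
  by rewrite /h circle_expD rmorphM !exprMn; ring.
have ch : cintegrable (haar R) h.
  apply/cintegrable_normcP; first exact: cmeasurable_monomial.
  apply: (@eq_integrable _ _ _ _ setT _ (cst 1%E)) => //; last first.
    exact: finite_measure_integrable_cst.
  move=> z _ /=; rewrite /h normcM !normcX normc_conj normc_circle !expr1n.
  by rewrite mulr1.
have [ij|ij] := eqVneq i j.
  rewrite (_ : h = fun=> 1) ?cint_cst//.
  by apply/funext => z; rewrite /h ij mulJX.
pose n := maxn (i - j) (j - i); pose s : R := - (2^-1 / n%:R).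
have n0 : n%:R != 0 :> R by rewrite pnatr_eq0 /n; lia.
have ns : cv (exp (- s)) ^+ n = -1.
  rewrite circle_expX -circle_exp_half /s opprK -[_ *+ n]mulr_natr divfK//.
have hs : h (exp (- s)) = -1.
  rewrite /h; have [ji|ji] := leqP j i.
    have -> : i = (j + n)%N by rewrite /n; lia.
    by rewrite exprD mulrAC mulJX mul1r ns.
  have -> : j = (i + n)%N by rewrite /n; lia.
  by rewrite exprD mulrA mulJX mul1r -rmorphXn ns rmorphN rmorph1.
have := cint_haar s (cintegrable_measurable ch).
under eq_fun do rewrite hM hs.
rewrite cintZ; last first.
  exact: cintegrable_haar0.
rewrite cint_haar0; last exact: cmeasurable_monomial.
rewrite mulN1r => /eqP; rewrite -subr_eq0 -opprD oppr_eq0 -mulr2n.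
by rewrite mulrn_eq0/= => /eqP.
Qed.

End haar_integral.

(** * Fourier coefficients *)

Section fourier.
Variable R : realType.
Local Notation C := R[i].
Local Notation cv z := (\val (z : circle R) : C).
Local Notation U := (uniform_prob (@ltr01 R)).
Local Notation exp := (@circle_exp R).
Local Notation H := (haar R).
Implicit Types f g : circleB R -> C.

Definition coef f (n : nat) : C := cint H (fun z => f z * (cv z)^* ^+ n).

Lemma cmeasurable_charJ n : cmeasurable (fun z : circleB R => (cv z)^* ^+ n).
Proof. by apply: cmeasurableX; apply: cmeasurableJ; exact: cmeasurable_circle. Qed.

Lemma normc_charJ n (z : circleB R) : normc ((cv z)^* ^+ n) = 1.
Proof. by rewrite normcX normc_conj normc_circle expr1n. Qed.

Lemma cintegrable_coef f n : cintegrable H f ->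
  cintegrable H (fun z => f z * (cv z)^* ^+ n).
Proof.
move=> fi; apply: (cintegrableM_bounded fi (cmeasurable_charJ n) (C := 1)) => z.
by rewrite normc_charJ.
Qed.

Lemma coef_lin (a : C) f g n : cintegrable H f -> cintegrable H g ->
  coef (fun z => a * f z + g z) n = a * coef f n + coef g n.
Proof.
move=> fi gi; rewrite /coef; under eq_fun do rewrite mulrDl -mulrA.
have fn := cintegrable_coef n fi; have gn := cintegrable_coef n gi.
by rewrite cintD ?cintZ//; exact: cintegrableZ.
Qed.

Lemma cmeasurable_horner (q : {poly C}) :
  cmeasurable (fun z : circleB R => q.[cv z]).
Proof. by apply: continuous_cmeasurable; exact: continuous_horner. Qed.

Lemma normc_horner_le (q : {poly C}) (z : circleB R) :
  normc q.[cv z] <= \sum_(i < size q) normc q`_i.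
Proof.
rewrite horner_coef (le_trans (normc_sum _ _ _))//; apply: ler_sum => i _.
by rewrite normcM normcX normc_circle expr1n mulr1.
Qed.

Lemma cintegrable_cst (a : C) : cintegrable H (fun=> a).
Proof. by split; exact: finite_measure_integrable_cst. Qed.

Lemma cintegrable_horner (q : {poly C}) : cintegrable H (fun z => q.[cv z]).
Proof.
have := cintegrableM_bounded (cintegrable_cst 1)
  (cmeasurable_horner q) (normc_horner_le q).
by under eq_fun do rewrite mul1r.
Qed.

Lemma cint_mulJ_sum f N (a : nat -> C) (e : nat -> nat) : cintegrable H f ->
  cint H (fun z => f z * (\sum_(k < N) a k * cv z ^+ e k)^*) =
  \sum_(k < N) (a k)^* * coef f (e k).
Proof.
move=> fi.
rewrite (_ : (fun z => _) =
    fun z => \sum_(k < N) (a k)^* * (f z * (cv z)^* ^+ e k)); last first.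
  apply/funext => z; rewrite rmorph_sum mulr_sumr.
  by apply: eq_bigr => k _; rewrite rmorphM rmorphXn/=; ring.
rewrite (@cint_sum _ _ _ H _ (fun k z => (a k)^* * (f z * (cv z)^* ^+ e k))).
  by apply: eq_bigr => k _; rewrite cintZ//; exact: cintegrable_coef.
by move=> k; apply: cintegrableZ; exact: cintegrable_coef.
Qed.

Lemma coef_horner (q : {poly C}) n : coef (fun z => q.[cv z]) n = q`_n.
Proof.
rewrite /coef (_ : (fun z => _) =
    fun z => \sum_(i < size q) q`_i * (cv z ^+ i * (cv z)^* ^+ n)); last first.
  apply/funext => z; rewrite horner_coef mulr_suml.
  by apply: eq_bigr => i _; rewrite mulrA.
have mi i : cintegrable H (fun z => cv z ^+ i * (cv z)^* ^+ n).
  have := cintegrable_coef n (cintegrable_horner 'X^i).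
  by under eq_fun do rewrite hornerXn.
rewrite (@cint_sum _ _ _ H _ 
  (fun i (z : circleB R) => q`_i * (cv z ^+ i * (cv z)^* ^+ n))); last first.
  by move=> k; exact: cintegrableZ.
under eq_bigr do rewrite cintZ// cint_monomial.
have [nq|nq] := ltnP n (size q).
  rewrite (bigD1 (Ordinal nq))//= eqxx mulr1 big1 ?addr0// => i /eqP ni.
  by case: eqP => [e|]; rewrite ?mulr0//; case: ni; exact: val_inj.
rewrite nth_default// big1// => i _; case: eqP => [e|]; rewrite ?mulr0//.
by move: (ltn_ord i); rewrite e ltnNge nq.
Qed.

Lemma coef_eq f g n : cintegrable H f -> cintegrable H g ->
  f = g %[ae H] -> coef f n = coef g n.
Proof.
move=> fi gi fg; rewrite /coef /cint /Rintegral.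
have := cintegrable_measurable (cintegrable_coef n fi).
have := cintegrable_measurable (cintegrable_coef n gi).
move=> [g1 g2] [f1 f2]; congr (fine _ +i* fine _).
- apply: ae_eq_integral => //; [exact/measurable_EFinP..|].
  by apply: filterS fg => z /= h _; rewrite h.
- apply: ae_eq_integral => //; [exact/measurable_EFinP..|].
  by apply: filterS fg => z /= h _; rewrite h.
Qed.

Lemma parseval (q : {poly C}) :
  \int[H]_z (normc q.[cv z] ^+ 2) = energy q.
Proof.
have := cint_mulJ_sum (size q) (fun k => q`_k) id (cintegrable_horner q).
under eq_fun do rewrite -horner_coef.
rewrite /cint => /(congr1 (@complex.Re R)) /=.
under eq_Rintegral do rewrite mulcJ/=.
move=> ->; rewrite -[energy q]/(complex.Re (energy q)%:C); congr complex.Re.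
rewrite /energy rmorph_sum; apply: eq_bigr => i _.
by rewrite coef_horner mulrC mulcJ.
Qed.

Lemma integrable_sqr_horner (q : {poly C}) :
  H.-integrable setT (fun z => (normc q.[cv z] ^+ 2)%:E).
Proof.
have qJ := cmeasurableJ (cmeasurable_horner q).
have [|+ _] := cintegrableM_bounded (cintegrable_horner q) qJ
    (C := \sum_(i < size q) normc q`_i).
  by move=> z; rewrite normc_conj normc_horner_le.
by under eq_fun do rewrite mulcJ.
Qed.

End fourier.

(** * Fourier coefficients of a convolution *)

Lemma integral_Re d (T : measurableType d) (R : realType)
    (mu : {measure set T -> \bar R}) (h : T -> R[i]) : cintegrable mu h ->
  (\int[mu]_z (complex.Re (h z))%:E = (complex.Re (cint mu h))%:E)%E.
Proof. by move=> [h1 h2]; rewrite /= fineK//; exact: integrable_fin_num h1. Qed.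

Lemma integral_Im d (T : measurableType d) (R : realType)
    (mu : {measure set T -> \bar R}) (h : T -> R[i]) : cintegrable mu h ->
  (\int[mu]_z (complex.Im (h z))%:E = (complex.Im (cint mu h))%:E)%E.
Proof. by move=> [h1 h2]; rewrite /= fineK//; exact: integrable_fin_num h2. Qed.

Section convolution_theorem.
Variable R : realType.
Local Notation C := R[i].
Local Notation cv z := (\val (z : circle R) : C).
Local Notation U := (uniform_prob (@ltr01 R)).
Local Notation exp := (@circle_exp R).
Local Notation H := (haar R).
Implicit Types f g : circleB R -> C.

Let ae_uniform_filter : Filter (almost_everywhere U).
Proof. exact: ae_filter_ringOfSetsType. Qed.
Local Existing Instance ae_uniform_filter.

Lemma cmeasurable_comp d1 d2 (T1 : measurableType d1) (T2 : measurableType d2)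
    (f : T2 -> C) (k : T1 -> T2) :
  cmeasurable f -> measurable_fun setT k -> cmeasurable (f \o k).
Proof.
by move=> [f1 f2] mk; split;
  [exact: (measurableT_comp f1)|exact: (measurableT_comp f2)].
Qed.

Lemma convolution_exp f g (t : R) : cmeasurable f -> cmeasurable g ->
  convolution f g (exp t) = cint U (fun s => f (exp s) * g (exp (t - s))).
Proof.
move=> mf mg; rewrite -[LHS]/(cint H (fun z => f z * g (circle_ldiv z (exp t)))).
rewrite -cint_haar0; first by under eq_fun do rewrite circle_ldiv_exp.
apply: cmeasurableM => //; apply: (cmeasurable_comp mg).
exact: measurable_circle_ldiv.
Qed.

Lemma ae_haar_exp (P : circleB R -> Prop) :
  (\forall z \ae H, P z) -> \forall t \ae U, P (exp t).
Proof.
move=> [N [mN N0 PN]]; exists (exp @^-1` N); split => //.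
- by rewrite -[X in measurable X]setTI; exact: measurable_circle_exp.
- by move=> t /= nP; exact: PN.
Qed.

Section kernel.
Variables f g : circleB R -> C.
Hypotheses (fi : cintegrable H f) (gi : cintegrable H g).

(** The parametrization turns the group law into subtraction on the line, which
    is jointly measurable; this is the kernel to which Fubini is applied. *)
Let K (st : measurableTypeR R * measurableTypeR R) : C :=
  f (exp st.1) * g (exp (st.2 - st.1)).

Let mK : cmeasurable K.
Proof.
apply: cmeasurableM.
- apply: (cmeasurable_comp (cintegrable_measurable fi)).
  by apply: (measurableT_comp (@measurable_circle_exp R)); exact: measurable_fst.
- apply: (cmeasurable_comp (cintegrable_measurable gi)).
  apply: (measurableT_comp (@measurable_circle_exp R)).
  by apply: measurable_funB; [exact: measurable_snd|exact: measurable_fst].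
Qed.

(** Tonelli and rotation invariance: the double integral of the modulus is the
    product of the L^1 norms. *)
Let iK : cintegrable (U \x U)%E K.
Proof.
apply/cintegrable_normcP => //; apply/integrable12ltyP.
  by apply/measurable_EFinP; exact: measurable_normc.
under eq_integral => x _.
  under eq_integral => y _.
    rewrite /K/= ger0_norm ?normc_ge0// normcM EFinM; over.
  rewrite ge0_integralZl_EFin ?normc_ge0//; last 2 first.
  - by move=> y _; rewrite lee_fin normc_ge0.
  - have mg : measurable_fun setT (fun z : circleB R => (normc (g z))%:E).
      exact/measurable_EFinP/measurable_normc/(cintegrable_measurable gi).
    exact: (measurableT_comp mg (measurable_circle_exp_translate x)).
  rewrite (@integral_haar_shift _ (fun z => (normc (g z))%:E)); last first.
    exact/measurable_EFinP/measurable_normc/(cintegrable_measurable gi).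
  rewrite -(@integral_haar _ (fun z => (normc (g z))%:E)); last first.
    exact/measurable_EFinP/measurable_normc/(cintegrable_measurable gi).
  over.
have /cintegrable_normcP := cintegrable_measurable gi => /(_ H)[/(_ gi) gn _].
have /cintegrable_normcP := cintegrable_measurable fi => /(_ H)[/(_ fi) fn _].
rewrite -(fineK (integrable_fin_num measurableT gn)).
rewrite -(@integral_haar _ (fun z => (normc (f z))%:E * _)%E); last first.
  apply: emeasurable_funM => //; exact: (measurable_int _ fn).
rewrite integralZr// muleC lte_mul_pinfty ?lee_fin//.
- by apply: fine_ge0; apply: integral_ge0 => z _; rewrite lee_fin normc_ge0.
- by rewrite ltey_eq (integrable_fin_num measurableT fn).
Qed.

Lemma convolution_kernel_integrable :
  \forall t \ae U, cintegrable U (fun s => f (exp s) * g (exp (t - s))).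
Proof.
move: iK => [/ae_integrable2 h1 /ae_integrable2 h2].
by apply: filterS2 h1 h2 => t /= ? ?; split.
Qed.

(** Integrating first in t gives the product of the integrals, by rotation
    invariance; integrating first in s gives 0 by hypothesis. *)
Lemma integral_convolution_kernel :
  (\forall t \ae U, cint U (fun s => f (exp s) * g (exp (t - s))) = 0) ->
  cint H f * cint H g = 0.
Proof.
move=> h0.
have KE s : cint U (fun t => K (s, t)) = f (exp s) * cint H g.
  rewrite /K/= cintZ; last exact: cintegrable_haar.
  by rewrite cint_haar//; exact: (cintegrable_measurable gi).
have iKs s : cintegrable U (fun t => K (s, t)).
  by rewrite /K/=; apply: cintegrableZ; exact: cintegrable_haar.
have fgE : cint U (fun s => f (exp s) * cint H g) = cint H f * cint H g.
  rewrite (cint_haar0 (f := fun z => f z * cint H g)); last first.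
    by apply: cmeasurableM;
      [exact: (cintegrable_measurable fi)|exact: cmeasurable_cst].
  by under eq_fun do rewrite mulrC; rewrite cintZ// mulrC.
have ifg : cintegrable U (fun s => f (exp s) * cint H g).
  have := cintegrable_haar 0 (cintegrableZ (cint H g) fi).
  by under eq_fun do rewrite subr0 mulrC.
have [iK1 iK2] := iK; have [m1 m2] := cintegrable_measurable ifg.
rewrite -fgE; apply/eqP; rewrite eq_complex/=; apply/andP; split; apply/eqP.
- have L : (\int[U]_s \int[U]_t (complex.Re (K (s, t)))%:E =
      (complex.Re (cint U (fun s => f (exp s) * cint H g)))%:E)%E.
    by under eq_integral do rewrite integral_Re// KE; rewrite integral_Re.
  have Z : (\int[U]_t \int[U]_s (complex.Re (K (s, t)))%:E = 0)%E.
    rewrite (ae_eq_integral (cst 0%E))//; first exact: integral0.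
      exact: (measurable_fubini_G iK1).
    apply: filterS2 h0 convolution_kernel_integrable => t /= t0 ti _.
    by rewrite integral_Re// t0.
  by have := Fubini iK1; rewrite /= L Z => -[].
- have L : (\int[U]_s \int[U]_t (complex.Im (K (s, t)))%:E =
      (complex.Im (cint U (fun s => f (exp s) * cint H g)))%:E)%E.
    by under eq_integral do rewrite integral_Im// KE; rewrite integral_Im.
  have Z : (\int[U]_t \int[U]_s (complex.Im (K (s, t)))%:E = 0)%E.
    rewrite (ae_eq_integral (cst 0%E))//; first exact: integral0.
      exact: (measurable_fubini_G iK2).
    apply: filterS2 h0 convolution_kernel_integrable => t /= t0 ti _.
    by rewrite integral_Im// t0.
  by have := Fubini iK2; rewrite /= L Z => -[].
Qed.

End kernel.

(** The character splits as the product of its values at s and at t - s, so the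
    previous lemma applies to f and g multiplied by it: their kernel is the
    kernel of f and g times a factor depending on t alone. *)
Lemma coef_mul_eq0 f g n : cintegrable H f -> cintegrable H g ->
  convolution f g = cst 0 %[ae H] -> coef f n * coef g n = 0.
Proof.
move=> fi gi fg0; apply: integral_convolution_kernel; [exact: cintegrable_coef..|].
apply: filterS2 (ae_haar_exp fg0) (convolution_kernel_integrable fi gi) => t /=.
move=> /(_ I); rewrite convolution_exp; [|exact: (cintegrable_measurable fi)
  |exact: (cintegrable_measurable gi)] => fgt ti.
rewrite (_ : (fun s : R => _) = fun s =>
    (cv (exp t))^* ^+ n * (f (exp s) * g (exp (t - s))));
  first by rewrite cintZ// fgt mulr0.
apply/funext => s; rewrite -[in RHS](subrKC s t) circle_expD rmorphM exprMn.
by rewrite [s + _]addrC addrK; ring.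
Qed.

End convolution_theorem.

(** * The lacunary inequality *)

Section lacunary_inequality.
Variable R : realType.
Local Notation C := R[i].
Local Notation cv z := (\val (z : circle R) : C).
Local Notation H := (haar R).
Implicit Types f g : circleB R -> C.

(** Young's inequality with the conjugate exponent q = p / (p - 1), which is then
    rounded up to the even integer 2 m. *)
Lemma young_even_power (p : R) : 1 < p -> exists2 m : nat, (0 < m)%N &
  forall a b : R, 0 <= a -> 0 <= b -> a * b <= 1 + a `^ p + (b ^+ m) ^+ 2.
Proof.
move=> p1; have p0 : 0 < p by rewrite (lt_trans _ p1).
pose q := p / (p - 1).
have q1 : 1 <= q by rewrite /q ler_pdivlMr ?subr_gt0// mul1r lerBlDr lerDl.
have q0 : 0 < q by rewrite (lt_le_trans _ q1).
have pq : p^-1 + q^-1 = 1.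
  rewrite /q invf_div -{1}[p^-1]mul1r -mulrDl addrC subrK divff//.
  by rewrite gt_eqF.
exists (Num.truncn q).+1 => // a b a0 b0; set m := _.+1.
have qm : q <= (m * 2)%:R.
  by rewrite (le_trans (ltW (truncnS_gt q)))// ler_nat; rewrite leq_pmulr.
apply: (le_trans (conjugate_powR a0 b0 p0 q0 pq)).
have h1 : a `^ p / p <= a `^ p by rewrite ler_piMr ?powR_ge0// invf_le1// ltW.
have h2 : b `^ q / q <= b `^ q by rewrite ler_piMr ?powR_ge0// invf_le1.
have h3 : b `^ q <= 1 + (b ^+ m) ^+ 2.
  have [b1|b1] := leP b 1.
    rewrite (@le_trans _ _ 1) ?lerDl ?sqr_ge0//.
    have : b `^ q <= 1 `^ q by apply: ge0_ler_powR; rewrite ?nnegrE// ltW.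
    by rewrite powR1.
  apply: (le_trans (ler_powR (ltW b1) qm)).
  by rewrite powR_mulrn// exprM lerDr.
lra.
Qed.

(** A modulus is at most 1 plus its p-th power. *)
Lemma cintegrable_powR (p : R) f : 1 < p -> cmeasurable f ->
  (\int[H]_z (normc (f z) `^ p)%:E < +oo)%E -> cintegrable H f.
Proof.
move=> p1 mf fp; apply/cintegrable_normcP => //.
have mn := measurable_normc mf.
have mp : measurable_fun setT (fun z => normc (f z) `^ p).
  exact: (measurableT_comp (measurable_powR p) mn).
have ip : H.-integrable setT (fun z => (normc (f z) `^ p)%:E).
  apply/integrableP; split; first exact/measurable_EFinP.
  by under eq_integral do rewrite gee0_abs ?lee_fin ?powR_ge0//.
apply: (@le_integrable _ _ _ H setT _ _
    (fun z => (1%:E + (normc (f z) `^ p)%:E)%E)) => //.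
- exact/measurable_EFinP.
- move=> z _; rewrite -EFinD !abse_EFin lee_fin.
  rewrite !ger0_norm ?normc_ge0 ?addr_ge0 ?powR_ge0//.
  have [n1|n1] := leP (normc (f z)) 1; last first.
    by rewrite (le_trans (le1r_powR (ltW n1) (ltW p1)))// lerDr.
  by rewrite (le_trans n1)// lerDl powR_ge0.
- by apply: integrableD => //; exact: finite_measure_integrable_cst.
Qed.

(** Hoelder's inequality in the weak form [young_even_power] reduces the bound to
    an even moment of the dual lacunary polynomial with square-summable
    coefficients of norm 1, which [energy_lacunary_exp] controls. *)
Lemma lacunary_bound (p : R) : 1 < p -> exists m : nat, (0 < m)%N /\ exists K : R,
  forall f N, cmeasurable f ->
    (\int[H]_z (normc (f z) `^ p)%:E <= 1)%E ->
    \sum_(k < N) normc (coef f (m.+2 ^ k)) ^+ 2 <= K ^+ 2.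
Proof.
move=> p1; have [m m0 young] := young_even_power p1.
exists m; split=> //; exists (2 + m%:R ^+ m).
move=> f N mf fp.
have fi : cintegrable H f.
  by apply: (cintegrable_powR p1 mf); rewrite (le_lt_trans fp)// ltry.
set S := \sum_(k < N) _.
have S0 : 0 <= S by apply: sumr_ge0 => k _; rewrite sqr_ge0.
have [->|SN0] := eqVneq S 0; first by rewrite sqr_ge0.
have {}S0 : 0 < S by rewrite lt_neqAle eq_sym SN0.
set s := Num.sqrt S; have s0 : 0 < s by rewrite sqrtr_gt0.
have Ss : S = s ^+ 2 by rewrite sqr_sqrtr// ltW.
rewrite Ss ler_pXn2r ?nnegrE ?(ltW s0) ?addr_ge0 ?exprn_ge0//.
pose c k := coef f (m.+2 ^ k) / s%:C.
have c1 : \sum_(k < N) normc (c k) ^+ 2 = 1.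
  rewrite /c; under eq_bigr do rewrite normcM normcV normc_real exprMn exprVn
    real_normK ?num_real//.
  by rewrite -mulr_suml -/S -Ss divff.
pose G := lacunary m.+2 c N.
have GE (z : circleB R) : G.[cv z] = \sum_(k < N) c k * cv z ^+ (m.+2 ^ k).
  rewrite /G /lacunary horner_sum; apply: eq_bigr => k _.
  by rewrite hornerZ hornerXn.
have Gf : cint H (fun z => f z * (G.[cv z])^*) = s%:C.
  under eq_fun do rewrite GE.
  rewrite (cint_mulJ_sum _ _ (fun k => m.+2 ^ k)%N)//.
  transitivity (\sum_(k < N) (normc (coef f (m.+2 ^ k)) ^+ 2 / s)%:C).
    have sV : (s%:C)^-1 = (s^-1)%:C by rewrite [RHS]fmorphV.
    apply: eq_bigr => k _; rewrite /c sV conjcM conjc_real.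
    by rewrite mulrAC [_^* * _]mulrC mulcJ -rmorphM.
  by rewrite -rmorph_sum -mulr_suml -/S Ss expr2 mulfK// gt_eqF.
have GJ := cmeasurableJ (cmeasurable_horner G).
have ifG : cintegrable H (fun z => f z * (G.[cv z])^*).
  apply: (cintegrableM_bounded fi GJ (C := \sum_(i < size G) normc G`_i)) => z.
  by rewrite normc_conj normc_horner_le.
have iG := integrable_sqr_horner (G ^+ m).
have mp : measurable_fun setT (fun z => normc (f z) `^ p).
  exact: (measurableT_comp (measurable_powR p) (measurable_normc mf)).
have ip : H.-integrable setT (fun z => (normc (f z) `^ p)%:E).
  apply/integrableP; split; first exact/measurable_EFinP.
  under eq_integral do rewrite gee0_abs ?lee_fin ?powR_ge0//.
  by rewrite (le_lt_trans fp)// ltry.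
have i1 : H.-integrable setT (fun=> 1%:E) by exact: finite_measure_integrable_cst.
have i1p := integrableD measurableT i1 ip.
have -> : s = \int[H]_z complex.Re (f z * (G.[cv z])^*).
  by rewrite -[s]/(complex.Re s%:C) -Gf.
apply: (@le_trans _ _
  (\int[H]_z (1 + normc (f z) `^ p + normc (G ^+ m).[cv z] ^+ 2))).
  apply: le_Rintegral => //; first by case: ifG.
    exact: (integrableD measurableT i1p iG).
  move=> z _; apply: (le_trans (ler_norm _)); apply: (le_trans (normRe_le _)).
  by rewrite normcM normc_conj horner_exp normcX young// normc_ge0.
rewrite RintegralD// RintegralD// parseval.
have -> : \int[H]_z 1 = 1 :> R.
  by have := cint_cst (1 : C) => /(congr1 (@complex.Re R)).
have hp : \int[H]_z (normc (f z) `^ p) <= 1.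
  rewrite -lee_fin /Rintegral fineK//.
  exact: integrable_fin_num ip.
have := energy_lacunary_exp c N m0 (leqnn m); rewrite -/G c1 expr1n mulr1 => hG.
by rewrite -[2]/(1 + 1) !lerD.
Qed.

End lacunary_inequality.

(** * Square-summable sequences *)

Section square_summable.
Variable R : realType.
Local Notation C := R[i].
Implicit Types x y : nat -> C.

(** The constant 2 comes from treating real and imaginary parts separately. *)
Lemma normc_cint_le d (T : measurableType d) (mu : {measure set T -> \bar R})
    (f : T -> C) : cintegrable mu f ->
  normc (cint mu f) <= 2 * \int[mu]_z normc (f z).
Proof.
move=> fi; have [f1 f2] := fi.
have /(cintegrable_normcP mu) [/(_ fi) fn _] := cintegrable_measurable fi.
apply: (le_trans (le_normc_ReIm _)); rewrite mulr_natl mulr2n /=; apply: lerD.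
- apply: (le_trans (le_normr_Rintegral _ f1)) => //.
  apply: le_Rintegral => //; first exact: integrable_norm.
  by move=> z _; exact: normRe_le.
- apply: (le_trans (le_normr_Rintegral _ f2)) => //.
  apply: le_Rintegral => //; first exact: integrable_norm.
  by move=> z _; exact: normIm_le.
Qed.

Local Notation cnt := (@counting nat R).

Definition square_sum_le x (X : R) := forall N, \sum_(k < N) normc (x k) ^+ 2 <= X.

Definition square_summable x := exists X, square_sum_le x X.

Lemma integral_counting_le (u : nat -> R) (B : R) : (forall k, 0 <= u k) ->
  (forall N, \sum_(k < N) u k <= B) -> (\int[cnt]_k (u k)%:E <= B%:E)%E.
Proof.
move=> u0 uB; rewrite ge0_integral_count => [|k]; last by rewrite lee_fin.
apply: lime_le.
  by apply: is_cvg_nneseries => n _ _; rewrite lee_fin.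
by apply: nearW => N; rewrite /= sumEFin lee_fin big_mkord.
Qed.

Lemma cmeasurable_counting (u : nat -> C) : cmeasurable u.
Proof. by split. Qed.

Lemma absolutely_summable (u : nat -> C) (B : R) :
  (forall N, \sum_(k < N) normc (u k) <= B) ->
  cintegrable cnt u /\ normc (cint cnt u) <= 2 * B.
Proof.
move=> uB; have h := integral_counting_le (fun k => normc_ge0 (u k)) uB.
have iu : cnt.-integrable setT (fun k => (normc (u k))%:E).
  apply/integrableP; split => //.
  under eq_integral do rewrite gee0_abs ?lee_fin ?normc_ge0//.
  by rewrite (le_lt_trans h)// ltry.
have ci : cintegrable cnt u.
  by apply/cintegrable_normcP => //; exact: cmeasurable_counting.
split=> //; apply: (le_trans (normc_cint_le ci)); rewrite ler_pM2l//.
rewrite -lee_fin /Rintegral fineK//.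
exact: integrable_fin_num iu.
Qed.

Lemma cint_counting1 (k0 : nat) : cint cnt (fun k => (k == k0)%:R : C) = 1.
Proof.
apply/eqP; rewrite eq_complex/=; apply/andP; split; apply/eqP.
- have -> : (fun k => complex.Re ((k == k0)%:R : C)) = \1_[set k0].
    by apply/funext => k; rewrite indicE; case: eqP => kk;
      [rewrite mem_set|rewrite memNset].
  have h : counting [set k0] = 1%:E :> \bar R.
    by rewrite /counting asboolT// fset_set1 finmap.cardfs1.
  by rewrite /Rintegral integral_indic// setIT; exact: (congr1 fine h).
- have -> : (fun k => complex.Im ((k == k0)%:R : C)) = cst 0.
    by apply/funext => k; case: eqP.
  by rewrite Rintegral_cst// mul0r.
Qed.

Lemma cint_counting_expn (M j : nat) : (1 < M)%N ->
  cint cnt (fun k => (j == M ^ k)%N%:R : C) = (lacunary_exp M j)%:R.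
Proof.
move=> M1; rewrite /lacunary_exp; have [jE|/eqP jN] := eqVneq j _.
  rewrite -[RHS](cint_counting1 (trunc_log M j)); congr cint; apply/funext => k.
  by rewrite {1}jE eqn_exp2l// eq_sym.
rewrite -[RHS](cint0 cnt); congr cint; apply/funext => k.
by case: eqP => // jE; case: jN; rewrite jE trunc_expnK.
Qed.

(** Series are integrals for the counting measure, so that the lemmas on complex
    integrals apply to them. *)
Definition pairing x y : C := cint cnt (fun k => x k * y k).

(** The weight t replaces the Cauchy-Schwarz inequality: it makes the bound small
    when Y is small compared to t and t is small. *)
Lemma pairing_bound x y (X Y t : R) : 0 < t ->
  square_sum_le x X -> square_sum_le y Y ->
  cintegrable cnt (fun k => x k * y k) /\ normc (pairing x y) <= t * X + t^-1 * Y.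
Proof.
move=> t0 hX hY.
have h N : \sum_(k < N) normc (x k * y k) <= (t * X + t^-1 * Y) / 2.
  apply: (@le_trans _ _ (\sum_(k < N)
      (t / 2 * normc (x k) ^+ 2 + t^-1 / 2 * normc (y k) ^+ 2))).
    apply: ler_sum => k _; rewrite normcM.
    set a := normc (x k); set b := normc (y k).
    rewrite -subr_ge0 [X in 0 <= X](_ : _ = t / 2 * (a - b / t) ^+ 2).
      by rewrite mulr_ge0 ?sqr_ge0// divr_ge0// ltW.
    by field; rewrite gt_eqF.
  rewrite big_split/= -!mulr_sumr mulrDl.
  have t20 : 0 <= t / 2 by rewrite divr_ge0// ltW.
  have t'20 : 0 <= t^-1 / 2 by rewrite divr_ge0// invr_ge0 ltW.
  rewrite [t * X / 2]mulrAC [t^-1 * Y / 2]mulrAC.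
  by apply: lerD; apply: ler_wpM2l => //;
    [exact: hX|exact: hY].
have [ci cb] := absolutely_summable (u := fun k => x k * y k) h; split => //.
by rewrite (le_trans cb)// mulrC divfK.
Qed.

Lemma pairing_integrable x y : square_summable x -> square_summable y ->
  cintegrable cnt (fun k => x k * y k).
Proof. by move=> [X hX] [Y hY]; have [] := pairing_bound ltr01 hX hY. Qed.

Lemma pairing_linr (a : C) x y z :
  square_summable x -> square_summable y -> square_summable z ->
  pairing x (fun k => a * y k + z k) = a * pairing x y + pairing x z.
Proof.
move=> hx hy hz; rewrite /pairing; under eq_fun do rewrite mulrDr mulrCA.
have xy := pairing_integrable hx hy; have xz := pairing_integrable hx hz.
by rewrite cintD ?cintZ//; exact: cintegrableZ.
Qed.

Lemma pairingC x y : pairing x y = pairing y x.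
Proof. by rewrite /pairing; under eq_fun do rewrite mulrC. Qed.

Lemma square_summableD x y : square_summable x -> square_summable y ->
  square_summable (fun k => x k + y k).
Proof.
move=> [X hX] [Y hY]; exists (2 * X + 2 * Y) => N.
apply: (@le_trans _ _ (\sum_(k < N) (2 * normc (x k) ^+ 2 + 2 * normc (y k) ^+ 2))).
  apply: ler_sum => k _; apply: (@le_trans _ _ ((normc (x k) + normc (y k)) ^+ 2)).
    by rewrite ler_pXn2r ?nnegrE ?addr_ge0 ?normc_ge0// le_normcD.
  by have := sqr_ge0 (normc (x k) - normc (y k)); lra.
rewrite big_split/= -!mulr_sumr.
by apply: lerD; rewrite ler_pM2l//; [exact: hX|exact: hY].
Qed.

Lemma pairingDr x y z :
  square_summable x -> square_summable y -> square_summable z ->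
  pairing x (fun k => y k + z k) = pairing x y + pairing x z.
Proof.
move=> hx hy hz; rewrite -[pairing x y]mul1r -pairing_linr//.
by congr pairing; apply/funext => k; rewrite mul1r.
Qed.

Lemma pairing_sqrD x y : square_summable x -> square_summable y ->
  pairing (fun k => x k + y k) (fun k => x k + y k) =
  pairing x x + pairing y y + 2 * pairing x y.
Proof.
move=> hx hy; have hxy := square_summableD hx hy.
set s := (X in pairing X X); rewrite {2}/s pairingDr//.
rewrite (pairingC s x) (pairingC s y).
by rewrite /s !pairingDr// (pairingC y x); ring.
Qed.

End square_summable.

(** * The sum of the squares of the lacunary coefficients *)

Section square_of_lacunary_coefficients.
Variable R : realType.
Local Notation C := R[i].
Local Notation cv z := (\val (z : circle R) : C).
Local Notation H := (haar R).
Local Notation F := (circleB R -> C).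
Implicit Types f g : F.

(** The norm of A dominates the L^p norm, in the homogeneous form [adm_norm], and
    is dominated by the supremum norm on continuous functions. *)
Record admissible (A : convAlgebra R) (p : R) : Prop := Admissible {
  adm_measurable : forall f, ca_carrier A f -> cmeasurable f ;
  adm_norm : forall f (r : R), 0 < r -> ca_carrier A f -> ca_norm A f < r ->
    (\int[H]_z (normc ((r^-1)%:C * f z) `^ p)%:E <= 1)%E ;
  adm_sub : forall f g, ca_carrier A f -> ca_carrier A g -> ca_carrier A (f \- g) ;
  adm_ae : forall f g, ca_eq A f g -> f = g %[ae H] ;
  adm_continuous : forall f (B : R), continuous (f : circle R -> C^o) ->
    (forall z, normc (f z) <= B) -> ca_carrier A f /\ ca_norm A f <= B }.

Variables (A : convAlgebra R) (p : R).
Hypotheses (p1 : 1 < p) (adm : admissible A p).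

Lemma adm_integrable f : ca_carrier A f -> cintegrable H f.
Proof.
move=> fA; pose r := `|ca_norm A f| + 1.
have r0 : 0 < r by rewrite /r ltr_wpDl.
have fr : ca_norm A f < r by rewrite /r (le_lt_trans (ler_norm _))// ltrDl.
have fp := adm_norm adm r0 fA fr.
have mrf : cmeasurable (fun z => (r^-1)%:C * f z).
  by apply: cmeasurableM; [exact: cmeasurable_cst|exact: (adm_measurable adm)].
have := cintegrableZ r%:C (cintegrable_powR p1 mrf (le_lt_trans fp (ltry _))).
have -> // : (fun z => r%:C * ((r^-1)%:C * f z)) = f.
apply/funext => z; rewrite mulrA -rmorphM divff ?gt_eqF//.
by rewrite rmorph1 mul1r.
Qed.

Lemma adm_horner (q : {poly C}) : ca_carrier A (fun z => q.[cv z]).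
Proof.
by case: (adm_continuous adm (@continuous_horner _ q) (normc_horner_le q)).
Qed.

Variables (m : nat) (K : R).
Hypothesis m0 : (0 < m)%N.
Hypothesis bound : forall f N, cmeasurable f ->
  (\int[H]_z (normc (f z) `^ p)%:E <= 1)%E ->
  \sum_(k < N) normc (coef f (m.+2 ^ k)) ^+ 2 <= K ^+ 2.

Definition lacunary_coef f (k : nat) := coef f (m.+2 ^ k).

Lemma lacunary_coef_square_sum f (r : R) :
  0 < r -> ca_carrier A f -> ca_norm A f < r ->
  square_sum_le (lacunary_coef f) ((K * r) ^+ 2).
Proof.
move=> r0 fA fr N.
have mrf : cmeasurable (fun z => (r^-1)%:C * f z).
  by apply: cmeasurableM; [exact: cmeasurable_cst|exact: (adm_measurable adm)].
have := bound N mrf (adm_norm adm r0 fA fr).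
have cE k : coef (fun z => (r^-1)%:C * f z) k = (r^-1)%:C * coef f k.
  rewrite /coef; under eq_fun do rewrite -mulrA.
  by rewrite cintZ//; apply/cintegrable_coef/adm_integrable.
under eq_bigr do rewrite cE normcM normc_real exprMn real_normK ?num_real// exprVn.
by rewrite -mulr_sumr mulrC ler_pdivrMr ?exprn_gt0// -exprMn.
Qed.

Lemma lacunary_coef_summable f : ca_carrier A f ->
  square_summable (lacunary_coef f).
Proof.
move=> fA; pose r := `|ca_norm A f| + 1.
have r0 : 0 < r by rewrite /r ltr_wpDl.
have fr : ca_norm A f < r by rewrite /r (le_lt_trans (ler_norm _))// ltrDl.
by exists ((K * r) ^+ 2); exact: lacunary_coef_square_sum.
Qed.

Lemma lacunary_coef_lin (a : C) f g : ca_carrier A f -> ca_carrier A g ->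
  lacunary_coef (a \*o f \+ g) = (fun k => a * lacunary_coef f k + lacunary_coef g k).
Proof.
by move=> fA gA; apply/funext => k; apply: coef_lin; exact: adm_integrable.
Qed.

Lemma lacunary_coefD f g : ca_carrier A f -> ca_carrier A g ->
  lacunary_coef (f \+ g) = (fun k => lacunary_coef f k + lacunary_coef g k).
Proof.
move=> fA gA; have -> : f \+ g = (1 : C) \*o f \+ g.
  by apply/funext => z /=; rewrite mul1r.
by rewrite lacunary_coef_lin//; apply/funext => k; rewrite mul1r.
Qed.

Definition lacunary_form f g : C := pairing (lacunary_coef f) (lacunary_coef g).
Definition lacunary_square f : C := lacunary_form f f.

Lemma lacunary_form_bilinear : bilinear_form A lacunary_form.
Proof.
have lin f : ca_carrier A f -> linear_functional A (lacunary_form f).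
  move=> fA; split=> [g h gA hA gh|a g h gA hA].
    congr pairing; apply/funext => k.
    by apply: coef_eq; [exact: adm_integrable..|exact: (adm_ae adm)].
  rewrite /lacunary_form lacunary_coef_lin//.
  by rewrite pairing_linr//; exact: lacunary_coef_summable.
split=> [f fA|g gA]; first exact: lin.
have -> : lacunary_form^~ g = lacunary_form g.
  by apply/funext => f; rewrite /lacunary_form pairingC.
exact: lin.
Qed.

Lemma lacunary_square_polynomial : homogeneous2_polynomial A lacunary_square.
Proof. exists lacunary_form; [exact: lacunary_form_bilinear|by move=> f _]. Qed.

Lemma lacunary_square_orthogonally_additive : orthogonally_additive A lacunary_square.
Proof.
move=> f g fA gA fg0 _; rewrite /lacunary_square /lacunary_form lacunary_coefD//.
rewrite pairing_sqrD//;
  [|exact: lacunary_coef_summable..].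
suff -> : pairing (lacunary_coef f) (lacunary_coef g) = 0 by rewrite mulr0 addr0.
rewrite /pairing -[RHS](cint0 (@counting nat R)); congr cint.
apply/funext => k; apply: coef_mul_eq0; [exact: adm_integrable..|].
exact: (adm_ae adm fg0).
Qed.

(** With u = g - f of norm less than d, expand P(f + u) = P(f) + P(u) + 2 B(f, u)
    for the associated form B. The sum of squares of the lacunary coefficients
    of u is at most (K d)^2, and [pairing_bound] with weight d makes both
    perturbations of order d. *)
Lemma lacunary_square_continuous : continuous_on_algebra A lacunary_square.
Proof.
move=> f fA e e0; have [B hB] := lacunary_coef_summable fA.
pose L := 2 * `|B| + 4 * K ^+ 2 + 1.
have L0 : 0 < L by rewrite /L ltr_wpDl// addr_ge0// mulr_ge0// sqr_ge0.
pose d := Num.min 1 (e / L).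
have d0 : 0 < d by rewrite /d lt_min ltr01 divr_gt0.
have d1 : d <= 1 by rewrite /d ge_min lexx.
have dL : d * L <= e by rewrite -ler_pdivlMr// /d ge_min lexx orbT.
exists d => // g gA gfd; set u := g \- f in gfd.
have uA : ca_carrier A u by exact: (adm_sub adm).
have hu := lacunary_coef_square_sum d0 uA gfd.
have -> : g = f \+ u by apply/funext => z; rewrite /u/= addrC subrK.
rewrite /lacunary_square /lacunary_form lacunary_coefD//.
rewrite pairing_sqrD//; [|exact: lacunary_coef_summable..].
have cancel (a b c : C) : a + b + c - a = b + c by rewrite addrC !addrA addNr add0r.
rewrite cancel.
have [_ b1] := pairing_bound ltr01 hu hu.
have [_ b2] := pairing_bound d0 hB hu.
have n2 : normc (2 : C) = 2.
  by rewrite -(rmorph_nat (real_complex R)) normc_real ger0_norm.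
have tri (a b : C) : normc (a + 2 * b) <= normc a + 2 * normc b.
  by rewrite (le_trans (le_normcD _ _))// normcM n2.
apply: (le_lt_trans (tri _ _)).
set x := normc (pairing (lacunary_coef u) (lacunary_coef u)) in b1.
set y := normc (pairing (lacunary_coef f) (lacunary_coef u)) in b2.
have Kd : (K * d) ^+ 2 <= K ^+ 2 * d.
  by rewrite exprMn ler_wpM2l ?sqr_ge0// expr2 ler_piMl// ltW.
have hx : x <= 2 * (K ^+ 2 * d).
  by apply: (le_trans b1); rewrite invr1 !mul1r mulr_natl mulr2n lerD.
have hy : y <= d * `|B| + K ^+ 2 * d.
  apply: (le_trans b2); apply: lerD; first by rewrite (ler_wpM2l (ltW d0))// ler_norm.
  by rewrite exprMn mulrCA expr2 mulKf// gt_eqF.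
apply: (lt_le_trans _ dL).
apply: (@le_lt_trans _ _ (2 * (K ^+ 2 * d) + 2 * (d * `|B| + K ^+ 2 * d))).
  by apply: lerD => //; rewrite ler_pM2l.
rewrite -subr_gt0 [X in 0 < X](_ : _ = d)// /L.
by ring.
Qed.

(** The integrand z^j (z^-1 w)^j is constant. *)
Lemma convolution_monomial j :
  convolution (fun z : circleB R => cv z ^+ j) (fun z => cv z ^+ j) =
  (fun z : circleB R => cv z ^+ j).
Proof.
apply/funext => w; rewrite -[RHS]cint_cst.
rewrite -[LHS]/(cint H (fun z => cv z ^+ j * ((cv z)^-1 * cv w) ^+ j)).
congr cint; apply/funext => z.
by rewrite -exprMn mulrA mulfV ?mul1r//; exact: circle_neq0.
Qed.

Lemma lacunary_square_monomial j :
  lacunary_square (fun z => cv z ^+ j) = (lacunary_exp m.+2 j)%:R.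
Proof.
rewrite -(@cint_counting_expn R)// /lacunary_square /lacunary_form /pairing; congr cint.
apply/funext => k; rewrite /lacunary_coef /coef cint_monomial.
by case: eqP; rewrite ?mulr1 ?mulr0.
Qed.

Section representing_functional.
Variable Phi : F -> C.
Hypotheses (PhiL : linear_functional A Phi)
  (PhiP : forall f, ca_carrier A f -> lacunary_square f = Phi (convolution f f)).

Lemma monomial_carrier j : ca_carrier A (fun z => cv z ^+ j).
Proof. by have := adm_horner 'X^j; under eq_fun do rewrite hornerXn. Qed.

Lemma functional0 : Phi (cst 0) = 0.
Proof.
have c0 := adm_horner 0; have := PhiL.2 (-1) _ _ c0 c0.
have -> : (-1 : C) \*o (fun z : circleB R => (0 : {poly C}).[cv z]) \+
    (fun z => (0 : {poly C}).[cv z]) = cst 0.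
  by apply/funext => z /=; rewrite horner0 mulr0 addr0.
by rewrite mulN1r addNr.
Qed.

(** On the idempotents z^j the functional is forced to agree with P. *)
Lemma functional_horner (q : {poly C}) :
  Phi (fun z => q.[cv z]) = lacunary_sum m.+2 q.
Proof.
pose S n := fun z : circleB R => \sum_(i < n) q`_i * cv z ^+ i.
have SA n : ca_carrier A (S n).
  have := adm_horner (\poly_(i < n) q`_i).
  rewrite (_ : (fun z => _) = S n)//; apply/funext => z.
  rewrite (horner_coef_wide _ (size_poly _ _)); apply: eq_bigr => i _.
  by rewrite coef_poly ltn_ord.
have -> : (fun z => q.[cv z]) = S (size q).
  by apply/funext => z; rewrite horner_coef.
rewrite /lacunary_sum; elim: (size q) => [|n IH].
  rewrite big_ord0 -[RHS]functional0; congr Phi.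
  by apply/funext => z; rewrite /S big_ord0.
have -> : S n.+1 = q`_n \*o (fun z => cv z ^+ n) \+ S n.
  by apply/funext => z; rewrite /S big_ord_recr/= addrC.
rewrite PhiL.2//; last exact: monomial_carrier.
have -> : Phi (fun z => cv z ^+ n) = (lacunary_exp m.+2 n)%:R.
  by rewrite -lacunary_square_monomial PhiP ?convolution_monomial//;
    exact: monomial_carrier.
by rewrite IH big_ord_recr/= addrC.
Qed.

(** The test polynomials stay bounded when t = 1/n and k = n^2, while the
    functional takes the value k t = n on them. *)
Lemma functional_discontinuous : ~ continuous_on_algebra A Phi.
Proof.
move=> Phic; have z0 : ca_carrier A (cst 0).
  by have := adm_horner 0; under eq_fun do rewrite horner0.
have [d d0 hd] := Phic _ z0 1 ltr01.
pose L : R := 1 + expR 1; have L0 : 0 < L by rewrite addr_gt0// expR_gt0.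
pose s := d / (2 * L); have s0 : 0 < s by rewrite divr_gt0// mulr_gt0.
pose n := (Num.truncn s^-1).+1.
have n0 : 0 < n%:R :> R by rewrite ltr0n.
have ns : 1 < s * n%:R by rewrite -ltr_pdivrMl// mulr1 truncnS_gt.
pose q := test_poly m.+2 (n%:R^-1 : R) (n ^ 2).
have qL (z : circleB R) : normc q.[cv z] <= L.
  set x := normc _; have x2 : x ^+ 2 <= expR 1.
    have := @normc_test_poly R m.+2 n%:R^-1 m0 (n ^ 2) _ (normc_circle z).
    move=> /le_trans; apply.
    apply: (@le_trans _ _ (expR (n%:R^-1 ^+ 2) ^+ (n ^ 2))).
      apply: lerXn2r; rewrite ?nnegrE ?expR_ge0 ?addr_ge0 ?sqr_ge0//.
      exact: expR_ge1Dx.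
    by rewrite -expRM_natl natrX -exprMn divff ?expr1n// gt_eqF.
  have [x1|x1] := leP x 1; first by rewrite (le_trans x1)// lerDl expR_ge0.
  rewrite (@le_trans _ _ (x ^+ 2)) ?expr2 ?ler_peMr ?(ltW x1) ?normc_ge0//.
  by rewrite (le_trans x2)// lerDr.
pose g z := (s%:C *: q).[cv z].
have gd (z : circleB R) : normc (g z) <= d / 2.
  have -> : d / 2 = s * L by rewrite /s invfM mulrA divfK// gt_eqF.
  by rewrite /g hornerZ normcM normc_real gtr0_norm// (ler_wpM2l (ltW s0)).
have [gA gN] := adm_continuous adm (@continuous_horner _ (s%:C *: q)) gd.
have := hd g gA; rewrite functional0 subr0.
have -> : g \- cst 0 = g by apply/funext => z /=; rewrite subr0.
have d2 : d / 2 < d by rewrite ltr_pdivrMr// ltr_pMr// ltr1n.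
move=> /(_ (le_lt_trans gN d2)).
rewrite functional_horner lacunary_sumZ lacunary_sum_test// normcM !normc_real.
rewrite gtr0_norm// natrX expr2 mulfK ?gt_eqF// gtr0_norm//.
by rewrite ltNge (ltW ns).
Qed.

End representing_functional.

Lemma lacunary_square_not_square : ~ exists Phi : F -> C,
  [/\ linear_functional A Phi, continuous_on_algebra A Phi &
      forall f, ca_carrier A f -> lacunary_square f = Phi (convolution f f)].
Proof.
by move=> [Phi [PhiL Phic PhiP]]; exact: (functional_discontinuous PhiL PhiP).
Qed.

End square_of_lacunary_coefficients.

(** * The algebras of exponent between one and infinity *)

Lemma Lnorm_ge0E d (T : measurableType d) (R : realType)
    (mu : {measure set T -> \bar R}) (p : R) (h : T -> R) :
  (forall z, 0 <= h z) ->
  ('N[mu]_p%:E[EFin \o h] = (\int[mu]_z (h z `^ p)%:E) `^ p^-1)%E.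
Proof.
move=> h0; rewrite Lnorm.unlock (eq_integral (fun z => (h z `^ p)%:E))// => z _.
by rewrite /= ger0_norm.
Qed.

Section lebesgue_algebras.
Variable R : realType.
Local Notation C := R[i].
Local Notation cv z := (\val (z : circle R) : C).
Local Notation H := (haar R).
Implicit Types f g : circleB R -> C.

Lemma integral_haar_cst (c : R) : (\int[H]_z c%:E = c%:E)%E.
Proof.
rewrite integral_cst//.
exact: (etrans (congr1 (mule c%:E) (@probability_setT _ _ _ H)) (mule1 _)).
Qed.

Lemma measurable_normc_powR (p : R) f : cmeasurable f ->
  measurable_fun setT (fun z => (normc (f z) `^ p)%:E).
Proof.
move=> mf; apply/measurable_EFinP.
exact: (measurableT_comp (measurable_powR p) (measurable_normc mf)).
Qed.

Lemma integral_normc_powR (p : R) f : p != 0 ->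
  (\int[H]_z (normc (f z) `^ p)%:E = Lp_norm p%:E f `^ p)%E.
Proof.
move=> p0; rewrite [Lp_norm _ _]Lnorm_ge0E => [|z]; last exact: normc_ge0.
rewrite -poweRrM mulVf// poweRe1//.
by apply: integral_ge0 => z _; rewrite lee_fin powR_ge0.
Qed.

Lemma Lp_norm_le (p : R) f (h : circleB R -> R) : 0 < p ->
  cmeasurable f -> measurable_fun setT h -> (forall z, normc (f z) <= h z) ->
  (Lp_norm p%:E f <= 'N[H]_p%:E[EFin \o h])%E.
Proof.
move=> p0 mf mh fh; have h0 z : 0 <= h z := le_trans (normc_ge0 _) (fh z).
rewrite [Lp_norm _ _]Lnorm_ge0E => [|z]; last exact: normc_ge0.
rewrite (Lnorm_ge0E _ _ h0).
have int0 (k : circleB R -> R) : (0 <= \int[H]_z (k z `^ p)%:E)%E.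
  by apply: integral_ge0 => z _; rewrite lee_fin powR_ge0.
apply: gt0_ler_poweR; rewrite ?in_itv/= ?leey ?int0 ?invr_ge0 ?(ltW p0)//.
apply: ge0_le_integral => //.
- by move=> z _; rewrite lee_fin powR_ge0.
- exact: measurable_normc_powR.
- by apply/measurable_EFinP; exact: (measurableT_comp (measurable_powR p) mh).
- by move=> z _; rewrite lee_fin ge0_ler_powR ?nnegrE ?normc_ge0// ltW.
Qed.

Lemma cmeasurableB f g : cmeasurable f -> cmeasurable g -> cmeasurable (f \- g).
Proof.
move=> mf mg; have -> : f \- g = (fun z => f z + (-1) * g z).
  by apply/funext => z /=; rewrite mulN1r.
by apply: cmeasurableD => //; apply: cmeasurableM => //; exact: cmeasurable_cst.
Qed.

Lemma normcB_le (x y : C) : normc (x - y) <= normc x + normc y.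
Proof. by rewrite (le_trans (le_normcD _ _))// normcN. Qed.

Lemma admissible_Lp (p : R) : 1 < p -> admissible (Lp_circle p%:E) p.
Proof.
move=> p1; have p0 : 0 < p by rewrite (lt_trans _ p1).
have pn0 : p != 0 by rewrite gt_eqF.
split=> /=.
- by move=> f [].
- move=> f r r0 [m1 m2 foo] fr.
  set N := Lp_norm p%:E f in foo fr.
  have N0 : (0 <= N)%E by exact: Lnorm_ge0.
  have Nfin : N \is a fin_num by rewrite ge0_fin_numE.
  have mf : cmeasurable f by [].
  have r10 : 0 <= r^-1 by rewrite invr_ge0 ltW.
  have IE : (\int[H]_z (normc ((r^-1)%:C * f z) `^ p)%:E =
      (r^-1 `^ p)%:E * N `^ p)%E.
    rewrite -[(N `^ p)%E](integral_normc_powR f pn0).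
    rewrite -ge0_integralZl_EFin ?powR_ge0//;
      [|by move=> z _; rewrite lee_fin powR_ge0|exact: measurable_normc_powR].
    apply: eq_integral => z _.
    by rewrite normcM normc_real ger0_norm// powRM// normc_ge0.
  rewrite IE -(fineK Nfin) poweR_EFin -EFinM lee_fin.
  have p1E : 1 `^ p = 1 :> R by rewrite powR1.
  rewrite -powRM ?fine_ge0// -[leRHS]p1E.
  apply: ge0_ler_powR; rewrite ?nnegrE ?mulr_ge0 ?fine_ge0 ?(ltW p0)//.
  by rewrite mulrC ler_pdivrMr// mul1r ltW.
- move=> f g [f1 f2 foo] [g1 g2 goo].
  have mf : cmeasurable f by [].
  have mg : cmeasurable g by [].
  have [h1 h2] := cmeasurableB mf mg; split => //.
  have mnf := measurable_normc mf; have mng := measurable_normc mg.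
  apply: (@le_lt_trans _ _ 
    ('N[H]_p%:E[EFin \o (fun z => normc (f z) + normc (g z))%R])%E).
    apply: Lp_norm_le => //; first exact: measurable_funD.
    by move=> z; exact: normcB_le.
  apply: (le_lt_trans (minkowski_EFin _ mnf mng (ltW p1))).
  exact: lte_add_pinfty.
- by [].
- move=> f B cf fB; have mf := continuous_cmeasurable cf.
  have B0 : 0 <= B := le_trans (normc_ge0 _) (fB (circle1 R)).
  have NB : (Lp_norm p%:E f <= B%:E)%E.
    apply: (le_trans (Lp_norm_le p0 mf (measurable_cst B) fB)).
    rewrite Lnorm_ge0E//= integral_haar_cst poweR_EFin -powRrM.
    by rewrite divff// powRr1.
  split; first by have [? ?] := mf; split=> //; rewrite (le_lt_trans NB)// ltry.
  rewrite -lee_fin fineK//.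
  by rewrite ge0_fin_numE ?Lnorm_ge0// (le_lt_trans NB)// ltry.
Qed.

End lebesgue_algebras.

(** * The algebras of bounded functions and of continuous functions *)

Section uniform_norm_algebras.
Variable R : realType.
Local Notation C := R[i].
Local Notation cv z := (\val (z : circle R) : C).
Local Notation H := (haar R).
Implicit Types f g : circleB R -> C.

(** The Haar measure is a probability, so the L^2 norm is at most the essential
    supremum. *)
Lemma ae_bounded_square (r : R) f : 0 < r -> cmeasurable f ->
  (\forall z \ae H, normc (f z) <= r) ->
  (\int[H]_z (normc ((r^-1)%:C * f z) `^ 2)%:E <= 1)%E.
Proof.
move=> r0 mf fr; rewrite -(integral_haar_cst (1 : R)).
have mrf : cmeasurable (fun z => (r^-1)%:C * f z).
  by apply: cmeasurableM => //; exact: cmeasurable_cst.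
apply: ae_ge0_le_integral => //.
- by move=> z _; rewrite lee_fin powR_ge0.
- exact: measurable_normc_powR.
have r10 : 0 <= r^-1 by rewrite invr_ge0 ltW.
apply: filterS fr => z fzr _; rewrite lee_fin powR_mulrn ?normc_ge0//.
rewrite expr_le1 ?normc_ge0// normcM normc_real ger0_norm//.
by rewrite mulrC ler_pdivrMr// mul1r.
Qed.

Lemma Loo_norm_le f (B : R) :
  (Lp_norm +oo%E f <= B%:E)%E <-> \forall z \ae H, normc (f z) <= B.
Proof.
have H0 : (0 < H setT)%E.
  apply: (lt_le_trans lte01).
  by rewrite -(mul1e (H setT)) -integral_cst// integral_haar_cst.
rewrite /Lp_norm Lnorm.unlock ifT//; split.
- move/ess_supP; apply: filterS => z /=.
  by rewrite lee_fin ger0_norm ?normc_ge0.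
- move=> fB; apply/ess_supP; apply: filterS fB => z zB /=.
  by rewrite lee_fin ger0_norm ?normc_ge0.
Qed.

Lemma admissible_Loo : admissible (Lp_circle (+oo%E : \bar R)) 2.
Proof.
have N0 f : (0 <= Lp_norm +oo%E f)%E by exact: Lnorm_ge0.
have Nfin f : (Lp_norm +oo%E f < +oo)%E ->
    (Lp_norm +oo%E f <= (fine (Lp_norm +oo%E f))%:E)%E.
  by move=> foo; rewrite fineK// ge0_fin_numE.
split=> /=.
- by move=> f [].
- move=> f r r0 [m1 m2 foo] fr; apply: ae_bounded_square => //.
  by apply/Loo_norm_le; rewrite (le_trans (Nfin f foo))// lee_fin ltW.
- move=> f g [f1 f2 foo] [g1 g2 goo].
  have mf : cmeasurable f by [].
  have mg : cmeasurable g by [].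
  have [h1 h2] := cmeasurableB mf mg; split => //.
  have /Loo_norm_le hf := Nfin f foo; have /Loo_norm_le hg := Nfin g goo.
  apply: (@le_lt_trans _ _ (fine (Lp_norm +oo%E f) + fine (Lp_norm +oo%E g))%:E).
    apply/Loo_norm_le; apply: filterS2 hf hg => z hfz hgz.
    by rewrite (le_trans (normcB_le _ _))// lerD.
  exact: ltry.
- by [].
- move=> f B cf fB; have mf := continuous_cmeasurable cf.
  have NB : (Lp_norm +oo%E f <= B%:E)%E by apply/Loo_norm_le; exact: aeW.
  split; first by have [? ?] := mf; split=> //; rewrite (le_lt_trans NB)// ltry.
  by rewrite -lee_fin fineK// ge0_fin_numE// (le_lt_trans NB)// ltry.
Qed.

Lemma circle_exp_surj (z : circleB R) :
  exists2 t : R, -1 <= t <= 1 & circle_exp t = z.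
Proof.
have pi0 := @pi_gt0 R.
have := mulcJ (cv z); rewrite normc_circle expr1n.
case E : (cv z) => [a b] /(congr1 (@complex.Re R)) /=.
rewrite mulrN opprK => ab.
have a1 : -1 <= a <= 1.
  rewrite -ler_norml -(@expr_le1 _ 2)// real_normK ?num_real// expr2 -ab.
  by rewrite lerDl -expr2 sqr_ge0.
have sE : sin (acos a) = `|b|.
  rewrite sin_acos// -sqrtr_sqr; congr Num.sqrt.
  by rewrite -ab !expr2; ring.
have cE : cos (acos a) = a by apply: acosK; rewrite in_itv.
have acos01 : 0 <= acos a / (2 * pi) <= 1.
  rewrite divr_ge0 ?acos_ge0 ?mulr_ge0 ?(ltW pi0)//= ler_pdivrMr ?mulr_gt0// mul1r.
  by rewrite (le_trans (acos_lepi a1))// mulr_natl mulr2n lerDl ltW.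
have mulK (u : R) : 2 * pi * (u / (2 * pi)) = u.
  by rewrite mulrC divfK// mulf_neq0// gt_eqF.
have [b0|b0] := leP 0 b.
  exists (acos a / (2 * pi)); first by case/andP: acos01; lra.
  apply: circle_ext; rewrite E /= mulK cE sE ger0_norm//.
exists (- (acos a / (2 * pi))); first by case/andP: acos01; lra.
by apply: circle_ext; rewrite E /= mulrN mulK cosN sinN cE sE ltr0_norm// opprK.
Qed.

(** Without this bound the supremum defining the norm of C could be a default
    value. It follows from the extreme value theorem on the parameter. *)
Lemma continuous_circle_bounded (f : circle R -> C) :
  continuous (f : circle R -> C^o) -> exists B : R, forall z, normc (f z) <= B.
Proof.
move=> cf.
have bnd (h : C -> R) : continuous (h : C^o -> R) ->
    exists B : R, forall z, `|h (f z)| <= B.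
  move=> ch; pose k t := h (f (circle_exp t)).
  have ck : continuous k.
    move=> t; apply: (@continuous_comp R C^o R (fun t => f (circle_exp t)) h t);
      last exact: ch.
    apply: (@continuous_comp R (circle R) C^o (@circle_exp R) f t);
      last exact: cf.
    exact: continuous_circle_exp.
  have le11 : -1 <= 1 :> R by lra.
  have [c _ hc] := EVT_max le11 (continuous_subspaceT ck).
  have [c' _ hc'] := EVT_min le11 (continuous_subspaceT ck).
  exists (`|k c| + `|k c'|) => z; have [t t1 <-] := circle_exp_surj z.
  rewrite -/(k t) ler_norml; have tin : t \in `[-1, 1] by rewrite in_itv.
  apply/andP; split.
    apply: le_trans (hc' t tin); rewrite lerNl.
    by rewrite (le_trans (ler_norm _))// normrN lerDr.
  by apply: (le_trans (hc t tin)); rewrite (le_trans (ler_norm _))// lerDl.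
have [B1 h1] := bnd _ (@continuous_Re R); have [B2 h2] := bnd _ (@continuous_Im R).
exists (B1 + B2) => z; apply: (le_trans (le_normc_ReIm _)); exact: lerD.
Qed.

Lemma admissible_C : admissible (C_circle R) 2.
Proof.
split=> /=.
- by move=> f cf; exact: continuous_cmeasurable.
- move=> f r r0 cf fr; apply: ae_bounded_square => //.
    exact: continuous_cmeasurable.
  apply: aeW => z; apply: le_trans (ltW fr).
  have [B hB] := continuous_circle_bounded cf.
  apply: ub_le_sup; last by exists z.
  by exists B => _ [w _ <-]; exact: hB.
- move=> f g cf cg z.
  exact: (@continuousB C C^o _ f g z (cf z) (cg z)).
- by move=> f g ->; exact: aeW.
- move=> f B cf fB; split=> //; apply: ge_sup.
    by exists (normc (f (circle1 R))), (circle1 R).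
  by move=> _ [z _ <-]; exact: fB.
Qed.

End uniform_norm_algebras.

(** * The theorem *)

Theorem mainTheorem5 (R : realType) (A : convAlgebra R)
    (hA : (exists2 p : \bar R, (1 < p)%E & A = Lp_circle p) \/
          A = C_circle R) :
  exists P : (circleB R -> R[i]) -> R[i],
    [/\ homogeneous2_polynomial A P,
        continuous_on_algebra A P,
        orthogonally_additive A P &
        ~ exists Phi : (circleB R -> R[i]) -> R[i],
            [/\ linear_functional A Phi, continuous_on_algebra A Phi &
                forall f, ca_carrier A f -> P f = Phi (convolution f f)]].
Proof.
have [p p1 adm] : exists2 p : R, 1 < p & admissible A p.
  have lt12 : 1 < 2 :> R by rewrite ltr1n.
  case: hA => [[[p| |] p1 ->]|->].
  - by exists p; [exact: p1|exact: admissible_Lp].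
  - by exists 2; [exact: lt12|exact: admissible_Loo].
  - by [].
  - by exists 2; [exact: lt12|exact: admissible_C].
have [m [m0 [K bound]]] := lacunary_bound p1.
exists (lacunary_square m); split.
- exact (lacunary_square_polynomial p1 adm bound).
- exact (lacunary_square_continuous p1 adm bound).
- exact (lacunary_square_orthogonally_additive p1 adm bound).
- exact (lacunary_square_not_square adm m0).
Qed.
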